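(* Let $\{R_n(t)\}_{n\in\mathbb{Z}}$ be the solution of the defocusing integrable discrete nonlinear Schrödinger equation $$ i\frac{d}{dt}R_n+(R_{n+1}-2R_n+R_{n-1})-|R_n|^2(R_{n+1}+R_{n-1})=0 $$ with rapidly decreasing initial data $\{R_n(0)\}$, and let $r(z)$, $|z|=1$, be the associated reflection coefficient. Let $V_0>0$ and consider Region C: $n>(2+V_0)t$. Then for every positive integer $j$ there is a constant $C=C(j,V_0)>0$ such that $|R_n(t)|\le Cn^{-j}$ in Region C. Moreover, if $r(z)$ is analytic on the circle $|z|=1$, then there exist constants $\rho=\rho(V_0)$ with $0<\rho<1$ and $C=C(V_0)>0$ such that $|R_n(t)|\le C\rho^n$ in Region C.
   Context: Rapidly decreasing initial data: for every $s>0$ there is $C_s>0$ with $|R_n(0)|\le C_s(1+|n|)^{-s}$ for all $n\in\mathbb{Z}$. Reflection coefficient: $r(z)$ is the reflection coefficient on the unit circle $C\colon|z|=1$ obtained from $\{R_n(0)\}$ by the direct scattering transform of the (defocusing) Ablowitz–Ladik spectral problem (normalization of Ablowitz–Prinari–Trubatch). Under the decay assumption, $r$ is smooth on $C$ and $|r|<1$. The solution is recovered as $R_n(t)=-\frac{d}{dz}m_{21}(z;n,t)\big|_{z=0}$, where the $2\times2$ matrix function $m$ is analytic in $|z|\ne1$, $m\to I$ as $z\to\infty$, and $m_+=m_-v$ on $C$ ($m_+$, $m_-$ the boundary values from outside and inside), with $v=e^{-\varphi\,\mathrm{ad}\,\sigma_3}\begin{bmatrix}1-|r|^2&-\bar r\\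 r&1\end{bmatrix}$, $\varphi=\tfrac{it}{2}(z-z^{-1})^2-n\log z$, $\sigma_3=\mathrm{diag}(1,-1)$, $a^{\mathrm{ad}\,\sigma_3}Q=a^{\sigma_3}Qa^{-\sigma_3}$. ''Analytic on the circle'' means $r$ extends analytically to a neighborhood of $|z|=1$ (e.g. this holds if $\{R_n(0)\}$ is finitely supported).
   Formalization: The formal theorem assumes |R_n(0)|<1 for all n (otherwise |r|<1 or the pole-free Riemann–Hilbert setting fails, e.g. R_0(0)=2 and the rest 0 gives |r|=2), and reads Region C with t≥0, so that n>0. *)

(* Defs.v *)
From Stdlib Require Import Reals ZArith.
From Coquelicot Require Import Coquelicot.
Open Scope R_scope.

Fixpoint Cpown (z : C) (k : nat) : C :=
  match k with O => RtoC 1 | S k => Cmult z (Cpown z k) end.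

Definition Cpowz (z : C) (k : Z) : C :=
  match k with
  | Z0 => RtoC 1
  | Zpos p => Cpown z (Pos.to_nat p)
  | Zneg p => Cinv (Cpown z (Pos.to_nat p))
  end.

Definition AL_rhs (R : Z -> C) (n : Z) (dRn : C) : C :=
  Cplus (Cplus (Cmult Ci dRn)
               (Cminus (Cplus (R (n + 1)%Z) (R (n - 1)%Z)) (Cmult (RtoC 2) (R n))))
        (Copp (Cmult (RtoC (Cmod (R n) ^ 2)) (Cplus (R (n + 1)%Z) (R (n - 1)%Z)))).

Definition is_AL_solution (u : R -> Z -> C) : Prop :=
  (forall (t : R) (n : Z), exists d : C,
      @is_derive R_AbsRing C_R_NormedModule (fun s => u s n) t d
      /\ AL_rhs (u t) n d = RtoC 0)
  /\ (forall T : R, exists M : R, forall (t : R) (n : Z),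
        Rabs t <= T -> Cmod (u t n) <= M).

Definition rapidly_decreasing (q : Z -> C) : Prop :=
  forall s : R, 0 < s -> exists Cs : R, 0 < Cs /\ forall n : Z,
      Cmod (q n) <= Cs * Rpower (1 + IZR (Z.abs n)) (- s).

Record mat2 := Mat2 { m11 : C; m12 : C; m21 : C; m22 : C }.
Definition mat2_mul (A B : mat2) : mat2 :=
  Mat2 (Cplus (Cmult (m11 A) (m11 B)) (Cmult (m12 A) (m21 B)))
       (Cplus (Cmult (m11 A) (m12 B)) (Cmult (m12 A) (m22 B)))
       (Cplus (Cmult (m21 A) (m11 B)) (Cmult (m22 A) (m21 B)))
       (Cplus (Cmult (m21 A) (m12 B)) (Cmult (m22 A) (m22 B))).
Definition mat2_id : mat2 := Mat2 (RtoC 1) (RtoC 0) (RtoC 0) (RtoC 1).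

(* Ablowitz-Ladik spectral problem  X_{n+1} = L_n(z) X_n,
   L_n(z) = [[z, conj R_n],[R_n, 1/z]].  In the interaction picture
   (conjugating by the free solution diag(z^n, z^-n)) one step is
   D^{-(n+1)} L_n D^n = I + [[0, conj(R_n) z^{-2n-1}],[R_n z^{2n+1}, 0]]. *)
Definition AL_step (q : Z -> C) (z : C) (n : Z) : mat2 :=
  Mat2 (RtoC 1) (Cmult (Cconj (q n)) (Cpowz z (- (2 * n + 1))))
       (Cmult (q n) (Cpowz z (2 * n + 1))) (RtoC 1).

Fixpoint AL_prod (q : Z -> C) (z : C) (m : Z) (k : nat) : mat2 :=
  match k with
  | O => mat2_id
  | S k' => mat2_mul (AL_step q z (m + Z.of_nat k')%Z) (AL_prod q z m k')
  end.

Definition AL_scat_trunc (q : Z -> C) (z : C) (N : nat) : mat2 :=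
  AL_prod q z (- Z.of_nat N)%Z (2 * N).

(* r is the reflection coefficient of the data q on the unit circle:
   the scattering matrix S(z) = lim_N AL_scat_trunc q z N = [[a, conj b],[b, conj a]]
   exists and r(z) = b(z)/a(z). *)
Definition is_reflection_coefficient (q : Z -> C) (r : C -> C) : Prop :=
  forall z : C, Cmod z = 1 ->
    exists a b : C,
      filterlim (fun N => m11 (AL_scat_trunc q z N)) eventually (locally a)
      /\ filterlim (fun N => m21 (AL_scat_trunc q z N)) eventually (locally b)
      /\ a <> RtoC 0
      /\ r z = Cdiv b a.

Definition analytic_on_circle (r : C -> C) : Prop :=
  exists (U : C -> Prop) (g : C -> C),
    open U
    /\ (forall z : C, Cmod z = 1 -> U z)
    /\ (forall z : C, U z -> @ex_derive C_AbsRing C_NormedModule g z)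
    /\ (forall z : C, Cmod z = 1 -> g z = r z).

(* Main.v *)
(** The argument works in physical space. For [e_n = - ln (1 - |u_n|^2)] the equation gives the
    conservation law [e_n' = J_(n-1) - J_n] with [|J_n| <= e_n + e_(n+1)], so energy travels
    at speed at most 2. Testing it against a logistic weight that moves inwards along the cone
    [|n - n0| = c (t0 - t)], with [c] slightly larger than 2, bounds [e_n0 (t0)] by the initial
    energy inside the base of the cone, up to an exponentially small error. In Region C this
    base lies to the right of [kappa n0], so [u] inherits the decay of the initial data at
    plus infinity.

    For the second claim it remains to see that analyticity of [r] forces exponential decay of
    [q n = u 0 n] as [n] grows. For the potential cut off to a window [[-M, M)], let [(A, B)],
    [(a, b)] and [(alpha, beta)] be the first columns of the scattering matrices of the whole
    window and of its parts left and right of [N]. On the circle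
    [alpha B - beta A = (|alpha|^2 - |beta|^2) b]. Divide by [A zeta^(2N+1)] and average over
    the circle: the [b] term extends analytically to the outside, where it vanishes at
    infinity, and the [beta] term extends to the inside with value [q N] at the centre; hence
    [q N] is the mean of [alpha (B / A) zeta^(-2N-1)]. As [M] grows, [B / A] tends to [r]
    uniformly while [alpha] stays bounded, and moving the contour to a larger circle gives
    [|q N| <= C exp (- delta N)]. Contours are moved by Goursat's theorem in the coordinate
    [log zeta], where the sides of the rectangle cancel by periodicity. *)

Require Import Defs.
From Stdlib Require Import Reals ZArith Lra Lia Psatz Classical ClassicalEpsilon.
From Coquelicot Require Import Coquelicot.
Open Scope R_scope.

(** * Goursat's theorem for real 1-forms on rectangles *)

(** The form is [P dx + Q dy]. The shared number [m] is both the y-derivative of [P] and the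
    x-derivative of [Q], which is closedness. The partial derivatives may be discontinuous, so
    Green's formula is out of reach and bisection takes its place. *)
Definition closed_form_on (P Q : R -> R -> R) (A B C D : R) : Prop :=
  forall x y, A <= x <= B -> C <= y <= D -> exists lx m ly,
    differentiable_pt_lim P x y lx m /\ differentiable_pt_lim Q x y m ly.

Definition boundary_integral (P Q : R -> R -> R) (a b c d : R) : R :=
  RInt (fun x => P x c) a b + RInt (fun y => Q b y) c d
  - RInt (fun x => P x d) a b - RInt (fun y => Q a y) c d.

Lemma differentiable_continuous_l (f : R -> R -> R) (x y lx ly : R) :
  differentiable_pt_lim f x y lx ly -> continuous (fun u => f u y) x.
Proof.
  intros H. apply continuity_pt_filterlim.
  assert (H2 : continuity_2d_pt f x y) by
    (apply differentiable_continuity_pt; now exists lx, ly).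
  intros eps Heps. destruct (H2 (mkposreal eps Heps)) as [d Hd].
  exists d; split; [apply cond_pos|]. intros u [_ Hu]. apply Hd; [exact Hu|].
  rewrite Rminus_diag, Rabs_R0. apply cond_pos.
Qed.

Lemma differentiable_continuous_r (f : R -> R -> R) (x y lx ly : R) :
  differentiable_pt_lim f x y lx ly -> continuous (fun v => f x v) y.
Proof.
  intros H. apply continuity_pt_filterlim.
  assert (H2 : continuity_2d_pt f x y) by
    (apply differentiable_continuity_pt; now exists lx, ly).
  intros eps Heps. destruct (H2 (mkposreal eps Heps)) as [d Hd].
  exists d; split; [apply cond_pos|]. intros u [_ Hu]. apply Hd; [|exact Hu].
  rewrite Rminus_diag, Rabs_R0. apply cond_pos.
Qed.

Lemma closed_form_ex_RInt_x (P Q : R -> R -> R) (A B C D a b y : R) :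
  closed_form_on P Q A B C D -> A <= a <= b -> b <= B -> C <= y <= D ->
  ex_RInt (fun x => P x y) a b.
Proof.
  intros H Ha Hb Hy. apply (ex_RInt_continuous (V := R_CompleteNormedModule)).
  intros x. rewrite Rmin_left, Rmax_right by lra. intros Hx.
  destruct (H x y) as (lx & m & ly & H1 & _); try lra.
  exact (differentiable_continuous_l _ _ _ _ _ H1).
Qed.

Lemma closed_form_ex_RInt_y (P Q : R -> R -> R) (A B C D x c d : R) :
  closed_form_on P Q A B C D -> A <= x <= B -> C <= c <= d -> d <= D ->
  ex_RInt (fun y => Q x y) c d.
Proof.
  intros H Hx Hc Hd. apply (ex_RInt_continuous (V := R_CompleteNormedModule)).
  intros y. rewrite Rmin_left, Rmax_right by lra. intros Hy.
  destruct (H x y) as (lx & m & ly & _ & H1); try lra.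
  exact (differentiable_continuous_r _ _ _ _ _ H1).
Qed.

Lemma RInt_split (f : R -> R) (a b c : R) :
  a <= b <= c -> ex_RInt f a c -> RInt f a c = RInt f a b + RInt f b c.
Proof.
  intros Hb Hf. symmetry. apply (RInt_Chasles (V := R_CompleteNormedModule)).
  - now apply (ex_RInt_Chasles_1 (V := R_CompleteNormedModule)) with c.
  - now apply (ex_RInt_Chasles_2 (V := R_CompleteNormedModule)) with a.
Qed.

(** The inner edges are traversed twice in opposite directions and cancel. *)
Lemma boundary_integral_quarters (P Q : R -> R -> R) (A B C D a c w h : R) :
  closed_form_on P Q A B C D -> 0 <= w -> 0 <= h ->
  A <= a -> a + w <= B -> C <= c -> c + h <= D ->
  let w' := w / 2 in let h' := h / 2 in
  let I a c := boundary_integral P Q a (a + w') c (c + h') in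
  boundary_integral P Q a (a + w) c (c + h)
  = I a c + I (a + w') c + I a (c + h') + I (a + w') (c + h').
Proof.
  intros H Hw Hh Ha Hb Hc Hd w' h' I. unfold I, boundary_integral.
  assert (Ew : a + w' + w' = a + w) by (unfold w'; lra).
  assert (Eh : c + h' + h' = c + h) by (unfold h'; lra).
  assert (0 <= w') by (unfold w'; lra). assert (0 <= h') by (unfold h'; lra).
  rewrite Ew, Eh.
  rewrite (RInt_split (fun x => P x c) a (a + w') (a + w)) by
    (try (apply (closed_form_ex_RInt_x P Q A B C D)); auto; lra).
  rewrite (RInt_split (fun x => P x (c + h)) a (a + w') (a + w)) by
    (try (apply (closed_form_ex_RInt_x P Q A B C D)); auto; lra).
  rewrite (RInt_split (fun y => Q a y) c (c + h') (c + h)) by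
    (try (apply (closed_form_ex_RInt_y P Q A B C D)); auto; lra).
  rewrite (RInt_split (fun y => Q (a + w) y) c (c + h') (c + h)) by
    (try (apply (closed_form_ex_RInt_y P Q A B C D)); auto; lra).
  lra.
Qed.

(** The bound is quadratic in the side lengths, so four bounds for the quarters add up exactly to
    the bound for the whole rectangle. *)
Definition small_boundary (P Q : R -> R -> R) (e a c w h : R) : Prop :=
  Rabs (boundary_integral P Q a (a + w) c (c + h)) <= 2 * e * (w + h) ^ 2.

Lemma RInt_near_const (f : R -> R) (a w m M : R) :
  0 <= w -> ex_RInt f a (a + w) ->
  (forall t, a <= t <= a + w -> Rabs (f t - m) <= M) ->
  Rabs (RInt f a (a + w) - w * m) <= w * M.
Proof.
  intros Hw Hf H.
  assert (Hc : ex_RInt (fun _ : R => m) a (a + w)) by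
    apply (ex_RInt_const (V := R_NormedModule)).
  replace (RInt f a (a + w) - w * m) with (RInt (fun t => f t - m) a (a + w)).
  - replace (w * M) with ((a + w - a) * M) by ring.
    apply abs_RInt_le_const; [lra| |exact H].
    now apply (ex_RInt_minus (V := R_NormedModule)).
  - transitivity (RInt f a (a + w) - RInt (fun _ => m) a (a + w)).
    + now apply (RInt_minus (V := R_CompleteNormedModule)).
    + rewrite (RInt_const (V := R_CompleteNormedModule)).
      unfold scal; simpl; unfold mult; simpl. ring.
Qed.

(** Near [(x, y)] both coefficients are affine up to [e * (w + h)]. For the affine part opposite
    sides contribute [- m * w * h] and [m * w * h], which cancel by closedness, so only the error
    terms survive. *)
Lemma small_boundary_near (P Q : R -> R -> R) (A B C D x y e : R) :
  closed_form_on P Q A B C D -> A <= x <= B -> C <= y <= D -> 0 < e ->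
  exists d, 0 < d /\ forall a c w h,
    A <= a <= x -> x <= a + w <= B -> C <= c <= y -> y <= c + h <= D ->
    w < d -> h < d -> small_boundary P Q e a c w h.
Proof.
  intros H Hx Hy He.
  destruct (H x y Hx Hy) as (lx & m & ly & HP & HQ).
  destruct (HP (mkposreal e He)) as [d1 H1]. destruct (HQ (mkposreal e He)) as [d2 H2].
  simpl in H1, H2.
  exists (Rmin d1 d2). split; [apply Rmin_pos; apply cond_pos|].
  intros a c w h Ha Hb Hc Hd Hw Hh.
  pose proof (Rmin_l d1 d2). pose proof (Rmin_r d1 d2).
  assert (near : forall u v, a <= u <= a + w -> c <= v <= c + h ->
    Rabs (P u v - P x y - (lx * (u - x) + m * (v - y))) <= e * (w + h) /\
    Rabs (Q u v - Q x y - (m * (u - x) + ly * (v - y))) <= e * (w + h)).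
  { intros u v Hu Hv.
    assert (Rabs (u - x) <= w) by (apply Rabs_le; lra).
    assert (Rabs (v - y) <= h) by (apply Rabs_le; lra).
    assert (Rmax (Rabs (u - x)) (Rabs (v - y)) <= w + h) by (apply Rmax_lub; lra).
    split; (eapply Rle_trans; [first [apply H1 | apply H2]; lra|]);
      apply Rmult_le_compat_l; lra. }
  unfold small_boundary, boundary_integral.
  assert (EP : forall v, C <= v <= D -> ex_RInt (fun x => P x v) a (a + w)) by
    (intros; apply (closed_form_ex_RInt_x P Q A B C D); auto; lra).
  assert (EQ : forall u, A <= u <= B -> ex_RInt (fun y => Q u y) c (c + h)) by
    (intros; apply (closed_form_ex_RInt_y P Q A B C D); auto; lra).
  (* Opposite sides are paired inside one integral: the terms in [lx] and the value [P x y] drop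
     out, and two errors of size [e * (w + h)] remain. The same is done for [Q] below. *)
  assert (IP : Rabs (RInt (fun u => P u c - P u (c + h)) a (a + w) - w * (- m * h))
               <= w * (2 * (e * (w + h)))).
  { apply RInt_near_const; [lra| |].
    - apply (ex_RInt_minus (V := R_NormedModule)); apply EP; lra.
    - intros t Ht. destruct (near t c) as [N1 _]; try lra.
      destruct (near t (c + h)) as [N2 _]; try lra.
      apply Rabs_le_between in N1. apply Rabs_le_between in N2.
      apply Rabs_le. lra. }
  assert (IQ : Rabs (RInt (fun v => Q (a + w) v - Q a v) c (c + h) - h * (m * w))
               <= h * (2 * (e * (w + h)))).
  { apply RInt_near_const; [lra| |].
    - apply (ex_RInt_minus (V := R_NormedModule)); apply EQ; lra.
    - intros t Ht. destruct (near (a + w) t) as [_ N1]; try lra.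
      destruct (near a t) as [_ N2]; try lra.
      apply Rabs_le_between in N1. apply Rabs_le_between in N2.
      apply Rabs_le. lra. }
  replace (RInt (fun u => P u c - P u (c + h)) a (a + w)) with
    (RInt (fun u => P u c) a (a + w) - RInt (fun u => P u (c + h)) a (a + w)) in IP by
    (symmetry; apply (RInt_minus (V := R_CompleteNormedModule)); apply EP; lra).
  replace (RInt (fun v => Q (a + w) v - Q a v) c (c + h)) with
    (RInt (fun v => Q (a + w) v) c (c + h) - RInt (fun v => Q a v) c (c + h)) in IQ by
    (symmetry; apply (RInt_minus (V := R_CompleteNormedModule)); apply EQ; lra).
  apply Rabs_le_between in IP. apply Rabs_le_between in IQ.
  apply Rabs_le. nra.
Qed.

Definition small_boundary_dec (P Q : R -> R -> R) (e a c w h : R) :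
  {small_boundary P Q e a c w h} + {~ small_boundary P Q e a c w h} :=
  Rle_dec _ _.

(** Lower left corner of the rectangle kept after [k] halvings. The first quarter that violates the
    bound is kept; the fourth is taken without a test once the other three pass. *)
Fixpoint bisect (P Q : R -> R -> R) (e a c w h : R) (k : nat) : R * R :=
  match k with
  | O => (a, c)
  | S k =>
      let (a, c) := bisect P Q e a c w h k in
      let w := w / 2 ^ S k in let h := h / 2 ^ S k in
      if small_boundary_dec P Q e a c w h then
        if small_boundary_dec P Q e (a + w) c w h then
          if small_boundary_dec P Q e a (c + h) w h then (a + w, c + h)
          else (a, c + h)
        else (a + w, c)
      else (a, c)
  end.

Lemma bisect_spec (P Q : R -> R -> R) (e a c w h : R) (k : nat) :
  closed_form_on P Q a (a + w) c (c + h) -> 0 <= w -> 0 <= h ->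
  ~ small_boundary P Q e a c w h ->
  let (a1, c1) := bisect P Q e a c w h k in
  let (a2, c2) := bisect P Q e a c w h (S k) in
  (a <= a1 /\ a1 + w / 2 ^ k <= a + w) /\ (c <= c1 /\ c1 + h / 2 ^ k <= c + h) /\
  (a1 <= a2 /\ a2 + w / 2 ^ S k <= a1 + w / 2 ^ k) /\
  (c1 <= c2 /\ c2 + h / 2 ^ S k <= c1 + h / 2 ^ k) /\
  ~ small_boundary P Q e a1 c1 (w / 2 ^ k) (h / 2 ^ k).
Proof.
  intros H Hw Hh Hbad.
  assert (Epow : forall s k, s / 2 ^ S k = (s / 2 ^ k) / 2).
  { intros s j. simpl. field. apply pow_nonzero. lra. }
  assert (pos : forall s k, 0 <= s -> 0 <= s / 2 ^ k).
  { intros s j Hs. apply Rdiv_le_0_compat; [lra|]. apply pow_lt. lra. }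
  assert (step : forall k,
    let (a1, c1) := bisect P Q e a c w h k in
    let (a2, c2) := bisect P Q e a c w h (S k) in
    (a1 <= a2 /\ a2 + w / 2 ^ S k <= a1 + w / 2 ^ k) /\
    (c1 <= c2 /\ c2 + h / 2 ^ S k <= c1 + h / 2 ^ k)).
  { intros j. simpl bisect. destruct (bisect P Q e a c w h j) as [a1 c1].
    change (2 * 2 ^ j) with (2 ^ S j). rewrite !Epow.
    pose proof (pos w j Hw). pose proof (pos h j Hh).
    repeat destruct small_boundary_dec; lra. }
  assert (inv : forall k, let (a1, c1) := bisect P Q e a c w h k in
    (a <= a1 /\ a1 + w / 2 ^ k <= a + w) /\ (c <= c1 /\ c1 + h / 2 ^ k <= c + h) /\
    ~ small_boundary P Q e a1 c1 (w / 2 ^ k) (h / 2 ^ k)).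
  { induction k0 as [|j IH].
    - simpl. replace (w / 1) with w by field. replace (h / 1) with h by field.
      repeat split; try lra; auto.
    - specialize (step j). revert step.
      destruct (bisect P Q e a c w h j) as [a1 c1] eqn:Ej.
      destruct (bisect P Q e a c w h (S j)) as [a2 c2] eqn:ESj.
      intros step. destruct IH as (I1 & I2 & I3). repeat split; try lra.
      intros G. simpl bisect in ESj. rewrite Ej in ESj.
      change (2 * 2 ^ j) with (2 ^ S j) in ESj. rewrite !Epow in ESj, G.
      apply I3. clear I3.
      pose proof (pos w j Hw) as Pw. pose proof (pos h j Hh) as Ph.
      set (w1 := w / 2 ^ j) in *. set (h1 := h / 2 ^ j) in *.
      pose proof (boundary_integral_quarters P Q a (a + w) c (c + h) a1 c1 w1 h1 H Pw Ph
                    ltac:(lra) ltac:(lra) ltac:(lra) ltac:(lra)) as Eq.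
      cbv zeta in Eq.
      destruct small_boundary_dec as [s1|s1] in ESj;
        [|now injection ESj as <- <-].
      destruct small_boundary_dec as [s2|s2] in ESj;
        [|now injection ESj as <- <-].
      destruct small_boundary_dec as [s3|s3] in ESj;
        [|now injection ESj as <- <-].
      injection ESj as <- <-.
      (* Three quarters passed their test and [G] says the fourth is small too; their sum makes the
         parent small, which the induction hypothesis excludes. *)
      unfold small_boundary in *. rewrite Eq.
      apply Rabs_le_between in s1. apply Rabs_le_between in s2.
      apply Rabs_le_between in s3. apply Rabs_le_between in G.
      apply Rabs_le.
      replace ((w1 / 2 + h1 / 2) ^ 2) with ((w1 + h1) ^ 2 / 4) in * by field. lra. }
  specialize (step k). specialize (inv k).
  destruct (bisect P Q e a c w h k) as [a1 c1].
  destruct (bisect P Q e a c w h (S k)) as [a2 c2]. tauto.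
Qed.

Lemma is_lim_seq_div_pow2 (s : R) : is_lim_seq (fun k => s / 2 ^ k) 0.
Proof.
  apply is_lim_seq_ext with (fun k => s * (/ 2) ^ k).
  - intros k. rewrite pow_inv. reflexivity.
  - replace (Finite 0) with (Rbar_mult s 0) by (simpl; f_equal; ring).
    apply is_lim_seq_scal_l. apply is_lim_seq_geom. rewrite Rabs_pos_eq; lra.
Qed.

Lemma nested_intervals (a : nat -> R) (w : R) :
  0 <= w ->
  (forall k, a k <= a (S k) /\ a (S k) + w / 2 ^ S k <= a k + w / 2 ^ k) ->
  exists x, forall k, a k <= x <= a k + w / 2 ^ k.
Proof.
  intros Hw H.
  assert (pos : forall k, 0 <= w / 2 ^ k).
  { intros j. apply Rdiv_le_0_compat; [lra|]. apply pow_lt. lra. }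
  assert (bnd : forall k, a k + w / 2 ^ k <= a O + w).
  { induction k as [|k IH]; [simpl; lra|]. specialize (H k). lra. }
  destruct (ex_finite_lim_seq_incr a (a O + w)) as [x Hx].
  - intros k. apply H.
  - intros k. specialize (bnd k). specialize (pos k). lra.
  - exists x. intros k. split.
    + apply (is_lim_seq_incr_compare a x Hx). intros j; apply H.
    + apply (is_lim_seq_decr_compare (fun k => a k + w / 2 ^ k)).
      * replace (Finite x) with (Rbar_plus x 0) by (simpl; f_equal; ring).
        apply is_lim_seq_plus'; [exact Hx | apply is_lim_seq_div_pow2].
      * intros j; apply H.
Qed.

(** If the quadratic bound failed for some [e], the bisection would yield nested failing rectangles
    shrinking to a point, where differentiability contradicts the failure. *)
Theorem goursat (P Q : R -> R -> R) (a b c d : R) :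
  a <= b -> c <= d -> closed_form_on P Q a b c d -> boundary_integral P Q a b c d = 0.
Proof.
  intros Hab Hcd H.
  set (w := b - a). set (h := d - c).
  assert (Hw : 0 <= w) by (unfold w; lra). assert (Hh : 0 <= h) by (unfold h; lra).
  replace b with (a + w) in * by (unfold w; ring).
  replace d with (c + h) in * by (unfold h; ring).
  clearbody w h.
  assert (key : forall e, 0 < e -> small_boundary P Q e a c w h).
  { intros e He. destruct (small_boundary_dec P Q e a c w h) as [s|bad]; [exact s|].
    exfalso.
    assert (sp := fun k => bisect_spec P Q e a c w h k H Hw Hh bad).
    destruct (nested_intervals (fun k => fst (bisect P Q e a c w h k)) w Hw) as [x Hx].
    { intros k. specialize (sp k).
      destruct (bisect P Q e a c w h k), (bisect P Q e a c w h (S k)).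
      unfold fst. tauto. }
    destruct (nested_intervals (fun k => snd (bisect P Q e a c w h k)) h Hh) as [y Hy].
    { intros k. specialize (sp k).
      destruct (bisect P Q e a c w h k), (bisect P Q e a c w h (S k)).
      unfold snd. tauto. }
    assert (x0 := Hx O). assert (y0 := Hy O). simpl in x0, y0.
    destruct (small_boundary_near P Q a (a + w) c (c + h) x y e H) as [dl [Hdl N]];
      try lra.
    destruct (proj2 (is_lim_seq_spec _ _) (is_lim_seq_div_pow2 w) (mkposreal dl Hdl))
      as [k1 K1].
    destruct (proj2 (is_lim_seq_spec _ _) (is_lim_seq_div_pow2 h) (mkposreal dl Hdl))
      as [k2 K2].
    set (k := max k1 k2).
    specialize (K1 k ltac:(lia)). specialize (K2 k ltac:(lia)). simpl in K1, K2.
    apply Rabs_lt_between in K1. apply Rabs_lt_between in K2.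
    specialize (Hx k). specialize (Hy k). specialize (sp k).
    destruct (bisect P Q e a c w h k) as [a1 c1].
    destruct (bisect P Q e a c w h (S k)) as [a2 c2]. simpl in Hx, Hy.
    apply sp. apply N; lra. }
  apply Rabs_eq_0, Rle_antisym; [|apply Rabs_pos].
  apply le_epsilon. intros e He. rewrite Rplus_0_l.
  (* The added 1 keeps [s] positive for a degenerate rectangle, so [e / s] is an admissible
     tolerance. *)
  set (s := 2 * (w + h) ^ 2 + 1).
  assert (Hs : 0 < s) by (unfold s; nra).
  eapply Rle_trans; [apply (key (e / s)); now apply Rdiv_lt_0_compat|].
  replace (2 * (e / s) * (w + h) ^ 2) with (e * ((2 * (w + h) ^ 2) / s)) by (field; lra).
  rewrite <- (Rmult_1_r e) at 2. apply Rmult_le_compat_l; [lra|].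
  apply Rmult_le_reg_r with s; [lra|]. unfold Rdiv. rewrite Rmult_assoc, Rinv_l by lra.
  unfold s; lra.
Qed.

(** Periodicity makes the two horizontal sides cancel in [goursat]. *)
Lemma vertical_integrals_eq (P Q : R -> R -> R) (a b c d : R) :
  a <= b -> c <= d -> closed_form_on P Q a b c d ->
  (forall x, P x c = P x d) ->
  RInt (fun y => Q a y) c d = RInt (fun y => Q b y) c d.
Proof.
  intros Hab Hcd H Hper. pose proof (goursat P Q a b c d Hab Hcd H) as G.
  unfold boundary_integral in G.
  rewrite (RInt_ext (V := R_CompleteNormedModule) (fun x => P x c) (fun x => P x d)) in G
    by (intros; apply Hper). lra.
Qed.

(** * Complex differentiability and circle means *)

Lemma Cmod_minus_sym (z w : C) : Cmod (z - w) = Cmod (w - z).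
Proof. replace (w - z)%C with (- (z - w))%C by ring. now rewrite Cmod_opp. Qed.

Lemma Cmod_le_abs (z : C) : Cmod z <= Rabs (fst z) + Rabs (snd z).
Proof.
  replace z with ((fst z, 0) + (0, snd z))%C at 1 by
    (destruct z; unfold Cplus; simpl; f_equal; ring).
  eapply Rle_trans; [apply Cmod_triangle|]. unfold Cmod; simpl.
  replace (fst z * (fst z * 1) + 0 * (0 * 1)) with (Rsqr (fst z)) by (unfold Rsqr; ring).
  replace (0 * (0 * 1) + snd z * (snd z * 1)) with (Rsqr (snd z)) by (unfold Rsqr; ring).
  rewrite !sqrt_Rsqr_abs. lra.
Qed.

Lemma abs_fst_le_Cmod (z : C) : Rabs (fst z) <= Cmod z.
Proof. eapply Rle_trans; [apply Rmax_l | apply Rmax_Cmod]. Qed.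

Lemma abs_snd_le_Cmod (z : C) : Rabs (snd z) <= Cmod z.
Proof. eapply Rle_trans; [apply Rmax_r | apply Rmax_Cmod]. Qed.

Lemma Cmod_triangle_minus (z w : C) : Cmod z <= Cmod w + Cmod (z - w).
Proof.
  replace z with (w + (z - w))%C at 1 by ring. apply Cmod_triangle.
Qed.

Definition continuous0 (f : C -> C) : Prop :=
  forall e, 0 < e -> exists d, 0 < d /\ forall v, Cmod v < d -> Cmod (f v - f 0) <= e.

Lemma continuous0_const (k : C) : continuous0 (fun _ => k).
Proof.
  intros e He. exists 1; split; [lra|]. intros v _.
  replace (k - k)%C with (RtoC 0) by ring. rewrite Cmod_0; lra.
Qed.

Lemma continuous0_id : continuous0 (fun v => v).
Proof.
  intros e He. exists e; split; [lra|]. intros v Hv.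
  replace (v - 0)%C with v by ring. lra.
Qed.

Lemma continuous0_plus (f g : C -> C) :
  continuous0 f -> continuous0 g -> continuous0 (fun v => f v + g v)%C.
Proof.
  intros Hf Hg e He. destruct (Hf (e / 2)) as (d1 & D1 & F); [lra|].
  destruct (Hg (e / 2)) as (d2 & D2 & G); [lra|].
  exists (Rmin d1 d2); split; [now apply Rmin_pos|]. intros v Hv.
  specialize (F v (Rlt_le_trans _ _ _ Hv (Rmin_l _ _))).
  specialize (G v (Rlt_le_trans _ _ _ Hv (Rmin_r _ _))).
  replace (f v + g v - (f 0 + g 0))%C with ((f v - f 0) + (g v - g 0))%C by ring.
  eapply Rle_trans; [apply Cmod_triangle|]. lra.
Qed.

Lemma continuous0_mult (f g : C -> C) :
  continuous0 f -> continuous0 g -> continuous0 (fun v => f v * g v)%C.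
Proof.
  intros Hf Hg e He.
  pose proof (Cmod_ge_0 (f 0)) as F0. pose proof (Cmod_ge_0 (g 0)) as G0.
  set (k := 1 + Cmod (f 0) + Cmod (g 0)).
  set (e' := Rmin 1 (e / k)).
  assert (Hk : 0 < k) by (unfold k; lra).
  assert (He' : 0 < e') by (apply Rmin_pos; [lra|now apply Rdiv_lt_0_compat]).
  assert (E1 : e' <= 1) by apply Rmin_l.
  assert (E2 : e' * k <= e).
  { apply Rle_trans with (e / k * k); [|right; field; lra].
    apply Rmult_le_compat_r; [lra|apply Rmin_r]. }
  destruct (Hf e' He') as (d1 & D1 & F). destruct (Hg e' He') as (d2 & D2 & G).
  exists (Rmin d1 d2); split; [now apply Rmin_pos|]. intros v Hv.
  specialize (F v (Rlt_le_trans _ _ _ Hv (Rmin_l _ _))).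
  specialize (G v (Rlt_le_trans _ _ _ Hv (Rmin_r _ _))).
  replace (f v * g v - f 0 * g 0)%C with
    ((f v - f 0) * g 0 + f 0 * (g v - g 0) + (f v - f 0) * (g v - g 0))%C by ring.
  eapply Rle_trans; [apply Cmod_triangle|].
  eapply Rle_trans; [apply Rplus_le_compat_r, Cmod_triangle|].
  rewrite !Cmod_mult.
  pose proof (Cmod_ge_0 (f v - f 0)%C). pose proof (Cmod_ge_0 (g v - g 0)%C).
  eapply Rle_trans; [|exact E2]. unfold k. nra.
Qed.

Lemma continuous0_inv (f : C -> C) :
  f 0 <> 0 -> continuous0 f -> continuous0 (fun v => / f v)%C.
Proof.
  intros H0 Hf e He. apply Cmod_gt_0 in H0 as M0.
  set (m := Cmod (f 0)) in *.
  destruct (Hf (Rmin (m / 2) (e * (m * m) / 2))) as (d & D & F).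
  { apply Rmin_pos; [lra|]. apply Rdiv_lt_0_compat; [|lra].
    apply Rmult_lt_0_compat; [lra|]. now apply Rmult_lt_0_compat. }
  exists d; split; [lra|]. intros v Hv. specialize (F v Hv).
  assert (F1 := Rle_trans _ _ _ F (Rmin_l _ _)).
  assert (F2 := Rle_trans _ _ _ F (Rmin_r _ _)).
  pose proof (Cmod_triangle_minus (f 0) (f v)) as T. rewrite Cmod_minus_sym in T.
  fold m in T. assert (L : m / 2 <= Cmod (f v)) by lra.
  assert (Hv0 : f v <> 0) by (apply Cmod_gt_0; lra).
  replace (/ f v - / f 0)%C with (- (f v - f 0) * / (f v * f 0))%C by (field; auto).
  rewrite Cmod_mult, Cmod_opp, Cmod_inv by (now apply Cmult_neq_0).
  rewrite Cmod_mult. fold m.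
  assert (P : 0 < Cmod (f v) * m) by nra.
  apply Rmult_le_reg_r with (Cmod (f v) * m); [exact P|].
  rewrite Rmult_assoc, Rinv_l, Rmult_1_r by lra.
  eapply Rle_trans; [exact F2|].
  apply Rle_trans with (e * (m / 2 * m)); [right; field|].
  apply Rmult_le_compat_l; [lra|]. apply Rmult_le_compat_r; lra.
Qed.

Lemma continuous0_comp (f g : C -> C) :
  g 0 = 0 -> continuous0 f -> continuous0 g -> continuous0 (fun v => f (g v)).
Proof.
  intros G0 Hf Hg e He. destruct (Hf e He) as (d1 & D1 & F).
  destruct (Hg (d1 / 2)) as (d2 & D2 & G); [lra|].
  exists d2; split; [lra|]. intros v Hv. rewrite G0. apply F.
  specialize (G v Hv). rewrite G0 in G.
  replace (g v - 0)%C with (g v) in G by ring. lra.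
Qed.

(** Carathéodory's form of the derivative: the slope [s] is continuous at the origin and the
    identity holds for every increment. Sum, product and chain rules then become algebraic
    identities between slopes. *)
Definition holomorphic_at (f : C -> C) (w : C) : Prop :=
  exists s, continuous0 s /\ forall v, (f (w + v) = f w + s v * v)%C.

Lemma holomorphic_continuous (f : C -> C) (w : C) :
  holomorphic_at f w -> continuous0 (fun v => f (w + v)%C).
Proof.
  intros (s & Hs & E) e He.
  destruct (continuous0_plus _ _ (continuous0_const (f w))
    (continuous0_mult _ _ Hs continuous0_id) e He) as (d & D & F).
  exists d; split; [lra|]. intros v Hv. rewrite !E. now apply F.
Qed.

Lemma holomorphic_const (k w : C) : holomorphic_at (fun _ => k) w.
Proof.
  exists (fun _ => 0%C); split; [apply continuous0_const|]. intros v; ring.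
Qed.

Lemma holomorphic_id (w : C) : holomorphic_at (fun z => z) w.
Proof.
  exists (fun _ => 1%C); split; [apply continuous0_const|]. intros v; ring.
Qed.

Lemma holomorphic_plus (f g : C -> C) (w : C) :
  holomorphic_at f w -> holomorphic_at g w -> holomorphic_at (fun z => f z + g z)%C w.
Proof.
  intros (s & Hs & E) (t & Ht & F). exists (fun v => s v + t v)%C.
  split; [now apply continuous0_plus|]. intros v. rewrite E, F. ring.
Qed.

Lemma holomorphic_mult (f g : C -> C) (w : C) :
  holomorphic_at f w -> holomorphic_at g w -> holomorphic_at (fun z => f z * g z)%C w.
Proof.
  intros Hf Hg. pose proof (holomorphic_continuous g w Hg) as Cg.
  destruct Hf as (s & Hs & E), Hg as (t & Ht & F).
  exists (fun v => s v * g (w + v) + f w * t v)%C. split.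
  - apply continuous0_plus; apply continuous0_mult; auto using continuous0_const.
  - intros v. rewrite E, F. ring.
Qed.

Lemma holomorphic_inv (f : C -> C) (w : C) :
  f w <> 0 -> holomorphic_at f w -> holomorphic_at (fun z => / f z)%C w.
Proof.
  intros H0 Hf. pose proof (holomorphic_continuous f w Hf) as Cf.
  destruct Hf as (s & Hs & E).
  destruct (Cf (Cmod (f w) / 2)) as (d & D & F).
  { apply Cmod_gt_0 in H0. lra. }
  set (t := fun v => (- s v * (/ f w * / f (w + v)))%C).
  assert (Ht : continuous0 t).
  { unfold t. apply continuous0_mult.
    - intros e He. destruct (Hs e He) as (d' & D' & F').
      exists d'; split; [lra|]. intros v Hv.
      replace (- s v - - s 0)%C with (- (s v - s 0))%C by ring.
      rewrite Cmod_opp. auto.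
    - apply continuous0_mult; [apply continuous0_const|].
      apply continuous0_inv; [|exact Cf]. now rewrite Cplus_0_r. }
  (* Far from [w] the function [f] may vanish, so the closed formula [t] for the slope is used only
     where [f] stays away from zero; elsewhere the plain difference quotient satisfies the
     identity. *)
  exists (fun v => if Rlt_dec (Cmod v) d then t v else (/ f (w + v) - / f w) / v)%C.
  split.
  - intros e He. destruct (Ht e He) as (d' & D' & F').
    exists (Rmin d d'). split; [now apply Rmin_pos|]. intros v Hv.
    pose proof (Rmin_l d d'). pose proof (Rmin_r d d').
    rewrite Cmod_0.
    destruct (Rlt_dec (Cmod v) d); [|lra]. destruct (Rlt_dec 0 d); [|lra].
    apply F'. lra.
  - intros v. destruct (Rlt_dec (Cmod v) d) as [l|l].
    + assert (f (w + v)%C <> RtoC 0).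
      { intros Z. specialize (F v l). rewrite Z, Cplus_0_r in F.
        replace (0 - f w)%C with (- f w)%C in F by ring. rewrite Cmod_opp in F.
        apply Cmod_gt_0 in H0. lra. }
      unfold t. replace (s v) with (s v * 1)%C by ring.
      transitivity (/ f w - (s v * v) * (/ f w * / f (w + v)))%C; [|ring].
      replace (s v * v)%C with (f (w + v) - f w)%C by (rewrite E; ring).
      field. auto.
    + assert (v <> 0) by (intros ->; rewrite Cmod_0 in l; lra).
      set (x := (/ f (w + v))%C). set (y := (/ f w)%C). field. auto.
Qed.

Lemma holomorphic_comp (f g : C -> C) (w : C) :
  holomorphic_at f (g w) -> holomorphic_at g w -> holomorphic_at (fun z => f (g z)) w.
Proof.
  intros (s & Hs & E) (t & Ht & F).
  exists (fun v => s (t v * v) * t v)%C. split.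
  - apply continuous0_mult; [|exact Ht].
    apply (continuous0_comp s (fun v => t v * v)%C); [ring|exact Hs|].
    apply continuous0_mult; [exact Ht|apply continuous0_id].
  - intros v. rewrite F, E. ring.
Qed.

Lemma holomorphic_of_remainder (f : C -> C) (w l : C) :
  (forall e, 0 < e -> exists d, 0 < d /\ forall v, Cmod v < d ->
     Cmod (f (w + v) - f w - l * v)%C <= e * Cmod v) ->
  holomorphic_at f w.
Proof.
  intros H.
  assert (dec : forall v : C, {v = 0} + {v <> 0}) by (intros; apply excluded_middle_informative).
  (* The difference quotient, completed at the origin by the derivative [l]. *)
  exists (fun v => if dec v then l else (f (w + v) - f w) / v)%C. split.
  - intros e He. destruct (H e He) as (d & D & F). exists d; split; [lra|].
    intros v Hv. destruct (dec 0) as [_|]; [|congruence].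
    destruct (dec v) as [->|Hn].
    + replace (l - l)%C with (RtoC 0) by ring. rewrite Cmod_0; lra.
    + specialize (F v Hv).
      replace ((f (w + v) - f w) / v - l)%C with ((f (w + v) - f w - l * v) * / v)%C
        by (field; auto).
      rewrite Cmod_mult, Cmod_inv by auto. apply Cmod_gt_0 in Hn.
      apply Rmult_le_reg_r with (Cmod v); [lra|].
      rewrite Rmult_assoc, Rinv_l; lra.
  - intros v. destruct (dec v) as [->|Hn].
    + rewrite Cplus_0_r. ring.
    + set (a := f (w + v)%C). set (b := f w). field. auto.
Qed.

Lemma holomorphic_of_ex_derive (f : C -> C) (w : C) :
  @ex_derive C_AbsRing C_NormedModule f w -> holomorphic_at f w.
Proof.
  intros (l & _ & H). apply (holomorphic_of_remainder f w l). intros e He.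
  specialize (H w (fun P HP => HP) (mkposreal e He)).
  destruct H as [d Hd]. exists d; split; [apply cond_pos|]. intros v Hv.
  specialize (Hd (w + v)%C). simpl in Hd.
  assert (B : @ball (AbsRing_UniformSpace C_AbsRing) w d (w + v)%C).
  { change (Cmod ((w + v) - w)%C < d). now replace ((w + v) - w)%C with v by ring. }
  specialize (Hd B).
  change (Cmod ((f (w + v) - f w) - ((w + v) - w) * l)%C
          <= e * Cmod ((w + v) - w)%C) in Hd.
  replace ((w + v) - w)%C with v in Hd by ring.
  now rewrite (Cmult_comm l v).
Qed.

(** * The complex exponential and integrals over circles in logarithmic coordinates *)

Definition cexp (w : C) : C := (exp (fst w) * cos (snd w), exp (fst w) * sin (snd w)).

Arguments cexp w%_C_scope.

Lemma cexp_plus (w v : C) : cexp (w + v) = (cexp w * cexp v)%C.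
Proof.
  unfold cexp, Cmult, Cplus; simpl. rewrite exp_plus, cos_plus, sin_plus.
  f_equal; ring.
Qed.

Lemma cexp_0 : cexp 0 = 1.
Proof. unfold cexp, RtoC; simpl. rewrite exp_0, cos_0, sin_0. f_equal; ring. Qed.

Lemma Cmod_cexp (w : C) : Cmod (cexp w) = exp (fst w).
Proof.
  unfold Cmod, cexp; simpl.
  replace (exp (fst w) * cos (snd w) * (exp (fst w) * cos (snd w) * 1) +
           exp (fst w) * sin (snd w) * (exp (fst w) * sin (snd w) * 1))
    with (Rsqr (exp (fst w)) * (Rsqr (sin (snd w)) + Rsqr (cos (snd w)))) by
    (unfold Rsqr; ring).
  rewrite sin2_cos2, Rmult_1_r. apply sqrt_Rsqr. left; apply exp_pos.
Qed.

Lemma cexp_neq_0 (w : C) : cexp w <> 0.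
Proof. apply Cmod_gt_0. rewrite Cmod_cexp. apply exp_pos. Qed.

Lemma cexp_opp (w : C) : cexp (- w) = (/ cexp w)%C.
Proof.
  assert (E : (cexp (- w) * cexp w = 1)%C).
  { rewrite <- cexp_plus, <- cexp_0. f_equal. ring. }
  rewrite <- (Cmult_1_l (/ cexp w)%C), <- E. field. apply cexp_neq_0.
Qed.

Lemma derive_remainder (f : R -> R) (x l : R) :
  is_derive f x l -> forall e, 0 < e ->
  exists d, 0 < d /\ forall h, Rabs h < d -> Rabs (f (x + h) - f x - l * h) <= e * Rabs h.
Proof.
  intros [_ H] e He. specialize (H x (fun P HP => HP) (mkposreal e He)).
  destruct H as [d Hd]. exists d; split; [apply cond_pos|]. intros h Hh.
  specialize (Hd (x + h)). simpl in Hd.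
  assert (B : ball x d (x + h)).
  { change (Rabs (minus (x + h) x) < d). unfold minus, plus, opp; simpl.
    now replace (x + h + - x) with h by ring. }
  specialize (Hd B). unfold minus, plus, opp, scal, mult in Hd; simpl in Hd.
  unfold mult in Hd; simpl in Hd.
  change (Rabs (f (x + h) + - f x + - ((x + h + - x) * l)) <= e * Rabs (x + h + - x)) in Hd.
  replace (x + h + - x) with h in Hd by ring.
  now replace (f (x + h) - f x - l * h) with (f (x + h) + - f x + - (h * l)) by ring.
Qed.

(** The functional equation reduces the claim to the origin, where the remainder is controlled by
    those of the real functions [exp], [cos] and [sin]. *)
Lemma holomorphic_cexp (w : C) : holomorphic_at cexp w.
Proof.
  apply (holomorphic_of_remainder _ _ (cexp w)). intros e He.
  (* The 6 is the total of the error coefficients 1 + 2 from the real part and 2 + 1 from the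
     imaginary part, with [exp x <= 2] near the origin. *)
  set (k := 6 * exp (fst w)). pose proof (exp_pos (fst w)) as Ew.
  assert (Hk : 0 < k) by (unfold k; lra).
  set (e' := Rmin 1 (e / k)).
  assert (He' : 0 < e') by (apply Rmin_pos; [lra|now apply Rdiv_lt_0_compat]).
  assert (E1 : e' <= 1) by apply Rmin_l.
  assert (E2 : k * e' <= e).
  { apply Rle_trans with (k * (e / k)); [|right; field; lra].
    apply Rmult_le_compat_l; [lra|apply Rmin_r]. }
  destruct (derive_remainder exp 0 (exp 0) (is_derive_exp 0) e' He') as (d1 & D1 & X).
  destruct (derive_remainder cos 0 (- sin 0) (is_derive_cos 0) e' He') as (d2 & D2 & Y).
  destruct (derive_remainder sin 0 (cos 0) (is_derive_sin 0) e' He') as (d3 & D3 & Z).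
  rewrite exp_0 in X. rewrite sin_0, cos_0 in Y, Z.
  set (d := Rmin (Rmin d1 (e' / 2)) (Rmin d2 d3)).
  assert (d <= d1 /\ d <= e' / 2 /\ d <= d2 /\ d <= d3) as (L1 & L2 & L3 & L4).
  { unfold d. pose proof (Rmin_l (Rmin d1 (e' / 2)) (Rmin d2 d3)).
    pose proof (Rmin_r (Rmin d1 (e' / 2)) (Rmin d2 d3)).
    pose proof (Rmin_l d1 (e' / 2)). pose proof (Rmin_r d1 (e' / 2)).
    pose proof (Rmin_l d2 d3). pose proof (Rmin_r d2 d3). lra. }
  exists d. split; [unfold d; repeat apply Rmin_pos; lra|].
  intros v Hv. rewrite cexp_plus.
  replace (cexp w * cexp v - cexp w - cexp w * v)%C
    with (cexp w * (cexp v - 1 - v))%C by ring.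
  rewrite Cmod_mult, Cmod_cexp.
  pose proof (abs_fst_le_Cmod v) as Vx. pose proof (abs_snd_le_Cmod v) as Vy.
  set (x := fst v) in *. set (y := snd v) in *.
  specialize (X x ltac:(lra)). specialize (Y y ltac:(lra)). specialize (Z y ltac:(lra)).
  rewrite !Rplus_0_l in X, Y, Z.
  pose proof (Rabs_pos x) as Px. pose proof (Rabs_pos y) as Py.
  assert (X1 : Rabs (exp x - 1) <= e').
  { replace (exp x - 1) with ((exp x - 1 - 1 * x) + x) by ring.
    eapply Rle_trans; [apply Rabs_triang|]. nra. }
  assert (X2 : exp x <= 2) by (apply Rabs_le_between in X1; lra).
  pose proof (exp_pos x) as X3.
  assert (B : Cmod (cexp v - 1 - v) <= 6 * e' * Cmod v).
  { eapply Rle_trans; [apply Cmod_le_abs|].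
    unfold cexp, Cminus, Cplus, Copp; simpl. fold x y.
    replace (exp x * cos y + - (1) + - x) with
      ((exp x - 1 - 1 * x) + exp x * (cos y - 1 - - 0 * y)) by ring.
    replace (exp x * sin y + - 0 + - y) with
      (exp x * (sin y - 0 - 1 * y) + (exp x - 1) * y) by ring.
    pose proof (Rabs_triang (exp x - 1 - 1 * x) (exp x * (cos y - 1 - - 0 * y))) as T1.
    pose proof (Rabs_triang (exp x * (sin y - 0 - 1 * y)) ((exp x - 1) * y)) as T2.
    rewrite Rabs_mult, (Rabs_pos_eq (exp x)) in T1 by lra.
    rewrite !Rabs_mult, (Rabs_pos_eq (exp x)) in T2 by lra.
    pose proof (Rabs_pos (cos y - 1 - - 0 * y)).
    pose proof (Rabs_pos (sin y - 0 - 1 * y)).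
    assert (exp x * Rabs (cos y - 1 - - 0 * y) <= 2 * (e' * Rabs y)) by
      (apply Rmult_le_compat; lra).
    assert (exp x * Rabs (sin y - 0 - 1 * y) <= 2 * (e' * Rabs y)) by
      (apply Rmult_le_compat; lra).
    assert (Rabs (exp x - 1) * Rabs y <= e' * Rabs y) by
      (apply Rmult_le_compat_r; lra).
    assert (e' * Rabs y <= e' * Cmod v) by (apply Rmult_le_compat_l; lra).
    assert (e' * Rabs x <= e' * Cmod v) by (apply Rmult_le_compat_l; lra).
    lra. }
  apply Rle_trans with (exp (fst w) * (6 * e' * Cmod v)).
  - apply Rmult_le_compat_l; [lra|]. exact B.
  - replace (exp (fst w) * (6 * e' * Cmod v)) with (k * e' * Cmod v) by (unfold k; ring).
    apply Rmult_le_compat_r; [apply Cmod_ge_0|exact E2].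
Qed.

(** The Cauchy-Riemann equations, with [p] and [q] the real and imaginary parts of the complex
    derivative [s 0]. *)
Lemma holomorphic_differentiable (f : C -> C) (x y : R) :
  holomorphic_at f (x, y) -> exists p q,
    differentiable_pt_lim (fun u v => fst (f (u, v))) x y p (- q) /\
    differentiable_pt_lim (fun u v => snd (f (u, v))) x y q p.
Proof.
  intros (s & Hs & E). exists (fst (s 0)), (snd (s 0)).
  assert (N : forall eps : posreal, locally_2d (fun u v =>
    Cmod (f (u, v) - f (x, y) - s 0 * ((u, v) - (x, y)))%C
    <= eps * Rmax (Rabs (u - x)) (Rabs (v - y))) x y).
  { intros [e He]. destruct (Hs (e / 2)) as (d & D & F); [lra|].
    assert (D' : 0 < d / 2) by lra. exists (mkposreal _ D'); simpl.
    intros u v Hu Hv. set (h := ((u, v) - (x, y))%C).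
    assert (Hh : Cmod h <= 2 * Rmax (Rabs (u - x)) (Rabs (v - y))).
    { eapply Rle_trans; [apply Cmod_le_abs|].
      replace (fst h) with (u - x) by (unfold h; simpl; ring).
      replace (snd h) with (v - y) by (unfold h; simpl; ring).
      pose proof (Rmax_l (Rabs (u - x)) (Rabs (v - y))).
      pose proof (Rmax_r (Rabs (u - x)) (Rabs (v - y))). lra. }
    assert (Hd : Cmod h < d).
    { eapply Rle_lt_trans; [exact Hh|].
      assert (Rmax (Rabs (u - x)) (Rabs (v - y)) < d / 2) by now apply Rmax_lub_lt.
      lra. }
    replace (u, v) with ((x, y) + h)%C by
      (unfold h, Cplus, Cminus, Copp; simpl; f_equal; ring).
    rewrite E.
    replace (f (x, y) + s h * h - f (x, y) - s 0 * h)%C with ((s h - s 0) * h)%C by ring.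
    rewrite Cmod_mult. specialize (F h Hd).
    apply Rle_trans with (e / 2 * Cmod h); [apply Rmult_le_compat_r; [apply Cmod_ge_0|exact F]|].
    apply Rle_trans with (e / 2 * (2 * Rmax (Rabs (u - x)) (Rabs (v - y)))).
    - apply Rmult_le_compat_l; [lra|exact Hh].
    - right; field. }
  split; intros eps; destruct (N eps) as [d Hd]; exists d; intros u v Hu Hv;
    (eapply Rle_trans; [|exact (Hd u v Hu Hv)]).
  - eapply Rle_trans; [|apply abs_fst_le_Cmod]. right. f_equal.
    destruct (f (u, v)), (f (x, y)), (s 0); simpl. ring.
  - eapply Rle_trans; [|apply abs_snd_le_Cmod]. right. f_equal.
    destruct (f (u, v)), (f (x, y)), (s 0); simpl. ring.
Qed.

(** [circle_integral f x] is the real part of the integral of [f(log z) dz / (i z)] over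
    the circle of radius [exp x]. *)
Definition circle_integral (f : C -> C) (x : R) : R :=
  RInt (fun y => fst (f (x, y))) 0 (2 * PI).

(** [snd f dx + fst f dy] is the imaginary part of [f dw]. It is closed by Cauchy-Riemann, and its
    vertical integrals are the circle integrals. *)
Lemma circle_integral_eq (f : C -> C) (a b : R) :
  a <= b ->
  (forall x y, a <= x <= b -> 0 <= y <= 2 * PI -> holomorphic_at f (x, y)) ->
  (forall x, f (x, 0) = f (x, 2 * PI)) ->
  circle_integral f a = circle_integral f b.
Proof.
  intros Hab H Hper. pose proof PI_RGT_0.
  apply (vertical_integrals_eq (fun x y => snd (f (x, y))) (fun x y => fst (f (x, y))));
    [exact Hab|lra| |intros x; now rewrite Hper].
  intros x y Hx Hy.
  destruct (holomorphic_differentiable f x y (H x y Hx Hy)) as (p & q & H1 & H2).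
  now exists q, p, (- q).
Qed.

Lemma ex_circle_integral (f : C -> C) (x : R) :
  (forall y, 0 <= y <= 2 * PI -> holomorphic_at f (x, y)) ->
  ex_RInt (fun y => fst (f (x, y))) 0 (2 * PI).
Proof.
  intros H. pose proof PI_RGT_0.
  apply (ex_RInt_continuous (V := R_CompleteNormedModule)). intros y Hy.
  rewrite Rmin_left, Rmax_right in Hy by lra.
  destruct (holomorphic_differentiable f x y (H y Hy)) as (p & q & H1 & _).
  exact (differentiable_continuous_r _ _ _ _ _ H1).
Qed.

Lemma circle_integral_bound (f : C -> C) (x M : R) :
  (forall y, 0 <= y <= 2 * PI -> holomorphic_at f (x, y)) ->
  (forall y, 0 <= y <= 2 * PI -> Cmod (f (x, y)) <= M) ->
  Rabs (circle_integral f x) <= 2 * PI * M.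
Proof.
  intros H HM. pose proof PI_RGT_0.
  replace (2 * PI * M) with ((2 * PI - 0) * M) by ring.
  apply abs_RInt_le_const; [lra|now apply ex_circle_integral|].
  intros y Hy. eapply Rle_trans; [apply abs_fst_le_Cmod|]. now apply HM.
Qed.

Lemma exp_decay_vanish (K i : R) :
  (forall x, 0 <= x -> Rabs i <= K * exp (- x)) -> i = 0.
Proof.
  intros H. apply Rabs_eq_0, Rle_antisym; [|apply Rabs_pos].
  assert (HK : 0 <= K).
  { specialize (H 0 ltac:(lra)). rewrite Ropp_0, exp_0 in H. pose proof (Rabs_pos i). lra. }
  apply le_epsilon. intros e He. rewrite Rplus_0_l.
  (* At [x = K / e] the inequality [1 + x <= exp x] already gives [K * exp (- x) <= e]. *)
  assert (Hx : 0 <= K / e) by (apply Rdiv_le_0_compat; lra).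
  eapply Rle_trans; [exact (H _ Hx)|]. rewrite exp_Ropp.
  pose proof (exp_ineq1_le (K / e)) as E.
  apply Rmult_le_reg_r with (exp (K / e)); [lra|].
  rewrite Rmult_assoc, Rinv_l by lra.
  apply Rle_trans with (e * (1 + K / e)).
  - replace (e * (1 + K / e)) with (e + K) by (field; lra). lra.
  - apply Rmult_le_compat_l; lra.
Qed.

(** The integral does not depend on the radius, so the circle can be pushed to infinity. The next
    lemma contracts it to the centre instead. *)
Lemma circle_integral_outer_vanish (f : C -> C) (K : R) :
  (forall x y, 0 <= x -> holomorphic_at f (x, y)) ->
  (forall x, f (x, 0) = f (x, 2 * PI)) ->
  (forall x y, 0 <= x -> Cmod (f (x, y)) <= K * exp (- x)) ->
  circle_integral f 0 = 0.
Proof.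
  intros H Hper HK. apply (exp_decay_vanish (2 * PI * K)). intros x Hx.
  rewrite (circle_integral_eq f 0 x Hx); [|intros; apply H; lra|exact Hper].
  rewrite Rmult_assoc. apply circle_integral_bound; intros; [now apply H|now apply HK].
Qed.

Lemma circle_integral_inner_vanish (f : C -> C) (K : R) :
  (forall x y, x <= 0 -> holomorphic_at f (x, y)) ->
  (forall x, f (x, 0) = f (x, 2 * PI)) ->
  (forall x y, x <= 0 -> Cmod (f (x, y)) <= K * exp x) ->
  circle_integral f 0 = 0.
Proof.
  intros H Hper HK. apply (exp_decay_vanish (2 * PI * K)). intros x Hx.
  rewrite <- (circle_integral_eq f (- x) 0); [|lra|intros; apply H; lra|exact Hper].
  rewrite Rmult_assoc. apply circle_integral_bound; intros; [apply H|apply HK]; lra.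
Qed.

(** * Energy in a cone *)

(** A smooth cut-off: close to 1 far inside the cone ([x] very negative), 1/2 on its surface,
    exponentially small outside. *)
Definition logistic (eps x : R) : R := / (1 + exp (eps * x)).

Definition logistic_slope (eps x : R) : R := eps * exp (eps * x) / (1 + exp (eps * x)) ^ 2.

Lemma logistic_pos (eps x : R) : 0 < logistic eps x.
Proof. pose proof (exp_pos (eps * x)). apply Rinv_0_lt_compat. lra. Qed.

Lemma logistic_le_1 (eps x : R) : logistic eps x <= 1.
Proof.
  pose proof (exp_pos (eps * x)). unfold logistic. rewrite <- Rinv_1.
  apply Rinv_le_contravar; lra.
Qed.

Lemma logistic_le_exp (eps x : R) : logistic eps x <= exp (- (eps * x)).
Proof.
  pose proof (exp_pos (eps * x)). rewrite exp_Ropp.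
  apply Rinv_le_contravar; lra.
Qed.

Lemma logistic_slope_nonneg (eps x : R) : 0 < eps -> 0 <= logistic_slope eps x.
Proof.
  intros He. pose proof (exp_pos (eps * x)).
  apply Rdiv_le_0_compat; [nra|]. apply pow_lt; lra.
Qed.

Lemma logistic_derive (eps x : R) :
  is_derive (logistic eps) x (- logistic_slope eps x).
Proof.
  pose proof (exp_pos (eps * x)). unfold logistic, logistic_slope.
  auto_derive; [lra|]. field. lra.
Qed.

(** The variation over one lattice bond is controlled by the slope at an endpoint. This comparison
    lets the decrease in time absorb the flux through the bond, and it fixes how small [eps] must
    be. *)
Lemma logistic_step (eps b x y : R) :
  0 < eps -> exp eps - 1 <= b * eps -> Rabs (x - y) <= 1 ->
  Rabs (logistic eps x - logistic eps y) <= b * logistic_slope eps x.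
Proof.
  intros He Hb Hxy. apply Rabs_le_between in Hxy.
  assert (mono : forall p q, p <= q -> exp p <= exp q).
  { intros p q [H| ->]; [left; now apply exp_increasing|lra]. }
  pose proof (mono (eps * y) (eps + eps * x) ltac:(nra)) as U1.
  pose proof (mono (eps * x) (eps + eps * y) ltac:(nra)) as U2.
  rewrite exp_plus in U1, U2.
  pose proof (mono 0 eps ltac:(lra)) as K. rewrite exp_0 in K.
  unfold logistic, logistic_slope.
  pose proof (exp_pos (eps * x)) as Pu. pose proof (exp_pos (eps * y)) as Pv.
  (* Since [x] and [y] differ by at most 1, [v <= k * u] and [u <= k * v]; what remains is algebra:
     [Rabs (v - u) * (1 + u) <= (k - 1) * u * (1 + v)]. *)
  set (u := exp (eps * x)) in *. set (v := exp (eps * y)) in *. set (k := exp eps) in *.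
  apply Rle_trans with ((k - 1) * u / (1 + u) ^ 2).
  - replace (/ (1 + u) - / (1 + v)) with ((v - u) / ((1 + u) * (1 + v))) by (field; lra).
    unfold Rdiv. rewrite Rabs_mult, (Rabs_pos_eq (/ _)) by
      (left; apply Rinv_0_lt_compat; nra).
    apply Rmult_le_reg_r with ((1 + u) ^ 2 * (1 + v)); [apply Rmult_lt_0_compat; nra|].
    replace (Rabs (v - u) * / ((1 + u) * (1 + v)) * ((1 + u) ^ 2 * (1 + v)))
      with (Rabs (v - u) * (1 + u)) by (field; lra).
    replace ((k - 1) * u * / (1 + u) ^ 2 * ((1 + u) ^ 2 * (1 + v)))
      with ((k - 1) * u * (1 + v)) by (field; lra).
    unfold Rabs. destruct (Rcase_abs (v - u)) as [H|H].
    + assert (- (v - u) <= (k - 1) * v) by nra.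
      assert (- (v - u) * u <= (k - 1) * v * u) by (apply Rmult_le_compat_r; lra).
      assert ((k - 1) * v <= (k - 1) * u) by (apply Rmult_le_compat_l; lra).
      nra.
    + assert (v - u <= (k - 1) * u) by nra.
      apply Rmult_le_compat; lra.
  - unfold Rdiv. rewrite <- Rmult_assoc. apply Rmult_le_compat_r.
    + left. apply Rinv_0_lt_compat, pow_lt. lra.
    + rewrite <- Rmult_assoc. apply Rmult_le_compat_r; lra.
Qed.

(* The weight travels inwards along the cone [|n - n0| = c (t0 - t)]; its slope in
   time pays for the flux through each bond. *)
Lemma cone_energy_derivative (e J : R -> Z -> R) (c eps t0 t : R) (n0 A : Z) (K : nat) :
  0 <= c -> 0 < eps -> exp eps - 1 <= c / 2 * eps ->
  (forall n, is_derive (fun s => e s n) t (J t (n - 1)%Z - J t n)) ->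
  (forall n, 0 <= e t n) ->
  (forall n, Rabs (J t n) <= e t n + e t (n + 1)%Z) ->
  (forall n, Rabs (J t n) <= 2) ->
  let x n s := IZR (Z.abs (n - n0)) - c * (t0 - s) in
  exists D,
    is_derive (fun s => sum_f_R0 (fun i => logistic eps (x (A + Z.of_nat i)%Z s)
                                           * e s (A + Z.of_nat i)%Z) K) t D /\
    let N := (A + Z.of_nat K)%Z in
    D <= 2 * logistic eps (x A t) - logistic eps (x N t) * J t N
         - c / 2 * logistic_slope eps (x N t) * e t N.
Proof.
  intros Hc He Hk De Pe J1 J2 x.
  assert (Dw : forall n, is_derive (fun s => logistic eps (x n s) * e s n) t
    (- c * logistic_slope eps (x n t) * e t n
     + logistic eps (x n t) * (J t (n - 1)%Z - J t n))).
  { intros n.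
    assert (D1 : is_derive (fun s => logistic eps (x n s)) t
                   (c * - logistic_slope eps (x n t))).
    { apply (is_derive_comp (logistic eps) (x n)); [apply logistic_derive|].
      unfold x. auto_derive; [exact I|ring]. }
    pose proof (is_derive_mult _ _ t _ _ D1 (De n) Rmult_comm) as D2.
    unfold plus, mult in D2; simpl in D2.
    replace (- c * logistic_slope eps (x n t) * e t n
     + logistic eps (x n t) * (J t (n - 1)%Z - J t n)) with
     (c * - logistic_slope eps (x n t) * e t n +
      logistic eps (x n t) * (J t (n - 1)%Z - J t n)) by ring.
    exact D2. }
  (* Summation by parts, one site at a time. The bound keeps the outgoing flux at the last site and
     half of its slope term; that half pays for the next bond. *)
  induction K as [|K IH].
  - simpl. rewrite Z.add_0_r. eexists; split; [apply Dw|].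
    pose proof (logistic_slope_nonneg eps (x A t) He).
    pose proof (logistic_pos eps (x A t)). specialize (Pe A).
    specialize (J2 (A - 1)%Z). apply Rabs_le_between in J2.
    assert (0 <= c * logistic_slope eps (x A t) * e t A) by
      (apply Rmult_le_pos; [apply Rmult_le_pos|]; lra).
    assert (logistic eps (x A t) * J t (A - 1)%Z <= logistic eps (x A t) * 2) by
      (apply Rmult_le_compat_l; lra).
    lra.
  - destruct IH as (D & HD & B). cbv zeta in B.
    set (N := (A + Z.of_nat K)%Z) in *.
    assert (EN : (A + Z.of_nat (S K))%Z = (N + 1)%Z) by (unfold N; lia).
    exists (D + (- c * logistic_slope eps (x (N + 1)%Z t) * e t (N + 1)%Z
     + logistic eps (x (N + 1)%Z t) * (J t N - J t (N + 1)%Z))).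
    split.
    + cbn [sum_f_R0]. rewrite EN. apply (is_derive_plus (K := R_AbsRing) (V := R_NormedModule)); [exact HD|].
      specialize (Dw (N + 1)%Z). now replace (N + 1 - 1)%Z with N in Dw by lia.
    + cbv zeta. rewrite EN.
      assert (S1 : Rabs (IZR (Z.abs (N - n0)) - IZR (Z.abs (N + 1 - n0))) <= 1).
      { rewrite <- minus_IZR, <- abs_IZR. apply IZR_le. lia. }
      assert (X1 : Rabs (x N t - x (N + 1)%Z t) <= 1).
      { unfold x. replace (_ - _) with
          (IZR (Z.abs (N - n0)) - IZR (Z.abs (N + 1 - n0))) by ring. exact S1. }
      pose proof X1 as X2. rewrite Rabs_minus_sym in X2.
      pose proof (logistic_step eps (c / 2) _ _ He Hk X1) as L1.
      pose proof (logistic_step eps (c / 2) _ _ He Hk X2) as L2.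
      set (w := logistic eps (x N t)) in *. set (w' := logistic eps (x (N + 1)%Z t)) in *.
      set (v := logistic_slope eps (x N t)) in *.
      set (v' := logistic_slope eps (x (N + 1)%Z t)) in *.
      pose proof (Pe N) as P1. pose proof (Pe (N + 1)%Z) as P2.
      (* The flux is bounded by the energies at both ends of the bond, and each energy is paired
         with the slope of the weight at its own site. *)
      assert (F : (w' - w) * J t N <= c / 2 * v * e t N + c / 2 * v' * e t (N + 1)%Z).
      { eapply Rle_trans; [apply Rle_abs|]. rewrite Rabs_mult, Rabs_minus_sym.
        apply Rle_trans with (Rabs (w - w') * (e t N + e t (N + 1)%Z)).
        - apply Rmult_le_compat_l; [apply Rabs_pos|apply J1].
        - rewrite Rmult_plus_distr_l. apply Rplus_le_compat;
            (apply Rmult_le_compat_r; [lra|]).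
          + exact L1.
          + rewrite Rabs_minus_sym. exact L2. }
      lra.
Qed.

Lemma sum_f_R0_term_le (f : nat -> R) (i K : nat) :
  (forall j, 0 <= f j) -> (i <= K)%nat -> f i <= sum_f_R0 f K.
Proof.
  intros Hf. induction K as [|K IH]; intros Hi.
  - replace i with O by lia. simpl; lra.
  - simpl. destruct (Nat.eq_dec i (S K)) as [->|Hn].
    + pose proof (cond_pos_sum f K Hf). lra.
    + specialize (IH ltac:(lia)). specialize (Hf (S K)). lra.
Qed.

(** Integrates the derivative bound over time. Only the two ends of the sum, at distance [L] from
    [n0], contribute to growth, and there the weight is at most
    [exp (- (eps * (INR L - c * t0)))]. *)
Lemma cone_energy_estimate (e J : R -> Z -> R) (c eps t0 : R) (n0 : Z) (L : nat) :
  0 <= c -> 0 < eps -> exp eps - 1 <= c / 2 * eps -> 0 <= t0 ->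
  (forall t n, 0 <= t <= t0 -> is_derive (fun s => e s n) t (J t (n - 1)%Z - J t n)) ->
  (forall t n, 0 <= t <= t0 -> 0 <= e t n) ->
  (forall t n, 0 <= t <= t0 -> Rabs (J t n) <= e t n + e t (n + 1)%Z) ->
  (forall t n, 0 <= t <= t0 -> Rabs (J t n) <= 2) ->
  e t0 n0 <= 2 * sum_f_R0 (fun i =>
      let n := (n0 - Z.of_nat L + Z.of_nat i)%Z in
      logistic eps (IZR (Z.abs (n - n0)) - c * t0) * e 0 n) (2 * L)
    + 8 * t0 * exp (- (eps * (INR L - c * t0))).
Proof.
  intros Hc He Hk Ht0 De Pe J1 J2.
  set (A := (n0 - Z.of_nat L)%Z). cbv zeta.
  set (x := fun n s => IZR (Z.abs (n - n0)) - c * (t0 - s)).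
  set (F := fun s => sum_f_R0 (fun i => logistic eps (x (A + Z.of_nat i)%Z s)
                                        * e s (A + Z.of_nat i)%Z) (2 * L)).
  set (b := exp (- (eps * (INR L - c * t0)))).
  assert (HF : forall t, 0 <= t <= t0 -> exists D, is_derive F t D /\ D <= 4 * b).
  { intros t Ht.
    destruct (cone_energy_derivative e J c eps t0 t n0 A (2 * L) Hc He Hk) as (D & HD & B);
      auto. exists D; split; [exact HD|]. cbv zeta in B. fold x in B.
    set (N := (A + Z.of_nat (2 * L))%Z) in *.
    change (D <= 2 * logistic eps (x A t) - logistic eps (x N t) * J t N
         - c / 2 * logistic_slope eps (x N t) * e t N) in B.
    assert (end_bound : forall n, Z.abs (n - n0) = Z.of_nat L -> logistic eps (x n t) <= b).
    { intros n Hn. eapply Rle_trans; [apply logistic_le_exp|]. unfold b.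
      assert (INR L - c * t0 <= x n t).
      { unfold x. rewrite Hn, <- INR_IZR_INZ. nra. }
      assert (Hm : - (eps * x n t) <= - (eps * (INR L - c * t0))) by nra.
      destruct Hm as [Hm|Hm]; [left; now apply exp_increasing|now rewrite Hm]. }
    pose proof (end_bound A ltac:(unfold A; lia)).
    pose proof (end_bound N ltac:(unfold N, A; lia)).
    pose proof (logistic_slope_nonneg eps (x N t) He).
    pose proof (logistic_pos eps (x N t)).
    specialize (Pe t N Ht). specialize (J2 t N Ht). apply Rabs_le_between in J2.
    assert (0 <= c / 2 * logistic_slope eps (x N t) * e t N) by
      (apply Rmult_le_pos; [apply Rmult_le_pos|]; lra).
    nra. }
  assert (HM : F t0 - F 0 <= 4 * b * t0).
  { destruct (Req_dec t0 0) as [->|Hn]; [lra|].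
    destruct (MVT_gen F 0 t0 (Derive F)) as (s & Hs & E).
    - intros s Hs. rewrite Rmin_left, Rmax_right in Hs by lra.
      destruct (HF s) as (D & HD & _); [lra|]. apply Derive_correct. now exists D.
    - intros s Hs. rewrite Rmin_left, Rmax_right in Hs by lra.
      destruct (HF s) as (D & HD & _); [lra|]. apply continuity_pt_filterlim.
      apply (ex_derive_continuous (K := R_AbsRing) (V := R_NormedModule)). now exists D.
    - rewrite Rmin_left, Rmax_right in Hs by lra.
      destruct (HF s) as (D & HD & B); [lra|].
      rewrite (is_derive_unique F s D HD) in E. rewrite E, Rminus_0_r.
      apply Rmult_le_compat_r; lra. }
  (* At the apex of the cone the logistic weight equals 1/2; this is the origin of the factor 2 in
     the conclusion. *)
  assert (H0 : / 2 * e t0 n0 <= F t0).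
  { unfold F. eapply Rle_trans; [|apply (sum_f_R0_term_le _ L); [|lia]].
    - cbv beta. replace (A + Z.of_nat L)%Z with n0 by (unfold A; lia).
      right. f_equal. unfold logistic, x.
      rewrite Z.sub_diag. simpl. rewrite !Rminus_diag, Rmult_0_r, Rminus_0_r, Rmult_0_r, exp_0.
      f_equal; lra.
    - intros j. apply Rmult_le_pos; [left; apply logistic_pos|]. apply Pe. lra. }
  assert (H1 : F 0 = sum_f_R0 (fun i =>
      logistic eps (IZR (Z.abs (A + Z.of_nat i - n0)) - c * t0)
      * e 0 (A + Z.of_nat i)%Z) (2 * L)).
  { unfold F, x. apply sum_eq. intros i _. now rewrite Rminus_0_r. }
  rewrite <- H1. lra.
Qed.

(** * Conservation law of the equation and persistence of the bound 1 on the modulus *)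

Lemma is_derive_fst_snd (f : R -> C) (t : R) (d : C) :
  @is_derive R_AbsRing C_R_NormedModule f t d ->
  is_derive (fun s => fst (f s)) t (fst d) /\ is_derive (fun s => snd (f s)) t (snd d).
Proof.
  intros H. split.
  - exact (filterdiff_comp' (U := R_NormedModule) (V := C_R_NormedModule)
      (W := R_NormedModule) f (fun z => fst z) t _ _ H
      (filterdiff_linear (fun z : C_R_NormedModule => fst z : R_NormedModule)
        (is_linear_fst (U := R_NormedModule) (V := R_NormedModule)))).
  - exact (filterdiff_comp' (U := R_NormedModule) (V := C_R_NormedModule)
      (W := R_NormedModule) f (fun z => snd z) t _ _ H
      (filterdiff_linear (fun z : C_R_NormedModule => snd z : R_NormedModule)
        (is_linear_snd (U := R_NormedModule) (V := R_NormedModule)))).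
Qed.

Lemma Cmod_sqr (z : C) : Cmod z ^ 2 = fst z ^ 2 + snd z ^ 2.
Proof. unfold Cmod. rewrite pow2_sqrt; [reflexivity|]. nra. Qed.

(** Twice the imaginary part of [Cconj (q n) * q (n + 1)]: the flow of energy from site [n] to site
    [n + 1]. *)
Definition bond_current (q : Z -> C) (n : Z) : R :=
  2 * (fst (q n) * snd (q (n + 1)%Z) - snd (q n) * fst (q (n + 1)%Z)).

Lemma is_derive_deficit (p q : R -> R) (t dp dq : R) :
  is_derive p t dp -> is_derive q t dq ->
  is_derive (fun s => 1 - (p s ^ 2 + q s ^ 2)) t (- 2 * (p t * dp + q t * dq)).
Proof.
  intros Dp Dq. assert (Ep : ex_derive p t) by (now exists dp).
  assert (Eq : ex_derive q t) by (now exists dq).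
  auto_derive; [auto|].
  replace (Derive (fun x => p x) t) with dp by (symmetry; now apply is_derive_unique).
  replace (Derive (fun x => q x) t) with dq by (symmetry; now apply is_derive_unique).
  ring.
Qed.

(** With [R] for the solution, the equation reads [i R_n' = 2 R_n - (1 - |R_n|^2) (R_(n+1) +
    R_(n-1))]. The first term only rotates the phase, so the derivative of [1 - |R_n|^2] carries
    this quantity as a factor. Dividing by it gives the conservation law. *)
Lemma AL_deficit_derive (u : R -> Z -> C) (t : R) (n : Z) :
  is_AL_solution u ->
  is_derive (fun s => 1 - Cmod (u s n) ^ 2) t
    ((1 - Cmod (u t n) ^ 2) * (bond_current (u t) n - bond_current (u t) (n - 1)%Z)).
Proof.
  intros [H _]. destruct (H t n) as (d & Hd & E).
  destruct (is_derive_fst_snd _ _ _ Hd) as [Dp Dq].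
  apply is_derive_ext with (fun s => 1 - (fst (u s n) ^ 2 + snd (u s n) ^ 2)).
  { intros s. now rewrite Cmod_sqr. }
  evar_last; [exact (is_derive_deficit _ _ _ _ _ Dp Dq)|]. clear Dp Dq Hd.
  unfold bond_current. replace (n - 1 + 1)%Z with n by lia.
  revert E. unfold AL_rhs. rewrite Cmod_sqr.
  destruct d as [d1 d2], (u t n) as [p q].
  destruct (u t (n + 1)%Z) as [p1 q1], (u t (n - 1)%Z) as [p0 q0].
  intros E. unfold Ci, Cminus, Copp, Cmult, Cplus, RtoC in E; simpl in E.
  injection E as E1 E2. simpl.
  replace d1 with (2 * q - (1 - (p * p + q * q)) * (q1 + q0)) by lra.
  replace d2 with (- 2 * p + (1 - (p * p + q * q)) * (p1 + p0)) by lra.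
  ring.
Qed.

(** [a ^ 2 * exp (2 * K * s)] is nondecreasing, so [a] cannot reach zero, and by the intermediate
    value theorem it cannot change sign. *)
Lemma positive_of_linear_ode (a g : R -> R) (K T : R) :
  0 <= T -> (forall t, is_derive a t (a t * g t)) ->
  (forall t, 0 <= t <= T -> Rabs (g t) <= K) -> 0 < a 0 -> 0 < a T.
Proof.
  intros HT Da Hg H0.
  assert (nz : forall t, 0 <= t <= T -> a t <> 0).
  { intros t Ht Z.
    set (f := fun s => a s ^ 2 * exp (2 * K * s)).
    destruct (MVT_gen f 0 t
      (fun s => 2 * a s ^ 2 * exp (2 * K * s) * (g s + K))) as (s & Hs & E).
    - intros s _. unfold f. pose proof (Da s) as Ds.
      assert (Ex : ex_derive a s) by (now exists (a s * g s)).
      auto_derive; [exact Ex|].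
      replace (Derive (fun x => a x) s) with (a s * g s) by
        (symmetry; now apply is_derive_unique).
      ring.
    - intros s _. apply continuity_pt_filterlim.
      apply (ex_derive_continuous (K := R_AbsRing) (V := R_NormedModule) f).
      unfold f. assert (Ex : ex_derive a s) by (now exists (a s * g s)).
      auto_derive. exact Ex.
    - rewrite Rmin_left, Rmax_right in Hs by lra. unfold f in E. rewrite Z in E.
      specialize (Hg s ltac:(lra)). apply Rabs_le_between in Hg.
      rewrite Rmult_0_r, exp_0 in E. pose proof (exp_pos (2 * K * s)).
      assert (0 <= 2 * a s ^ 2 * exp (2 * K * s) * (g s + K) * (t - 0)).
      { pose proof (pow2_ge_0 (a s)).
        repeat (apply Rmult_le_pos; [|lra]). lra. }
      nra. }
  assert (Ca : continuity a).
  { intros t. apply continuity_pt_filterlim.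
    apply (ex_derive_continuous (K := R_AbsRing) (V := R_NormedModule)).
    now exists (a t * g t). }
  destruct (Rtotal_order (a T) 0) as [Hn|[Hn|Hn]]; [|exfalso; now apply (nz T); [lra|]|lra].
  exfalso. destruct (IVT_gen a 0 T 0 Ca) as (t & Ht & Z).
  - rewrite Rmin_right, Rmax_left; lra.
  - rewrite Rmin_left, Rmax_right in Ht by lra. now apply (nz t).
Qed.

Lemma bond_current_le (q : Z -> C) (n : Z) :
  Rabs (bond_current q n) <= Cmod (q n) ^ 2 + Cmod (q (n + 1)%Z) ^ 2.
Proof.
  rewrite !Cmod_sqr. unfold bond_current.
  destruct (q n) as [a b], (q (n + 1)%Z) as [c d]; simpl. apply Rabs_le.
  pose proof (pow2_ge_0 (a - d)). pose proof (pow2_ge_0 (a + d)).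
  pose proof (pow2_ge_0 (b - c)). pose proof (pow2_ge_0 (b + c)). nra.
Qed.

(** The local bound [M] contained in [is_AL_solution] bounds the coefficient of the linear equation
    for the deficit. Positivity makes the logarithmic energy well defined. *)
Lemma AL_defocusing (u : R -> Z -> C) (t : R) (n : Z) :
  is_AL_solution u -> (forall n, Cmod (u 0 n) < 1) -> 0 <= t -> 0 < 1 - Cmod (u t n) ^ 2.
Proof.
  intros Hu H0 Ht. destruct (proj2 Hu t) as [M HM].
  apply (positive_of_linear_ode (fun s => 1 - Cmod (u s n) ^ 2)
    (fun s => bond_current (u s) n - bond_current (u s) (n - 1)%Z) (4 * M ^ 2)); auto.
  - intros s. now apply AL_deficit_derive.
  - intros s Hs. rewrite Rabs_minus_sym. eapply Rle_trans; [apply Rabs_triang|].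
    rewrite Rabs_Ropp.
    assert (B : forall k, Cmod (u s k) ^ 2 <= M ^ 2).
    { intros k. apply pow_incr. split; [apply Cmod_ge_0|].
      apply HM. rewrite Rabs_pos_eq; lra. }
    pose proof (bond_current_le (u s) n). pose proof (bond_current_le (u s) (n - 1)%Z).
    pose proof (B n). pose proof (B (n + 1)%Z). pose proof (B (n - 1)%Z).
    pose proof (B (n - 1 + 1)%Z). lra.
  - specialize (H0 n). pose proof (Cmod_ge_0 (u 0 n)). nra.
Qed.

Lemma neg_ln_ge (x : R) : x < 1 -> x <= - ln (1 - x).
Proof.
  intros H. pose proof (exp_ineq1_le (ln (1 - x))) as E.
  rewrite exp_ln in E; lra.
Qed.

Lemma neg_ln_le (x s : R) : 0 <= x -> x <= s -> s < 1 -> - ln (1 - x) <= x / (1 - s).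
Proof.
  intros H0 Hs H1. pose proof (exp_ineq1_le (- ln (1 - x))) as E.
  pose proof (exp_ineq1_le (ln (/ (1 - x)))) as E2.
  rewrite exp_ln in E2 by (apply Rinv_0_lt_compat; lra).
  rewrite ln_Rinv in E2 by lra.
  apply Rle_trans with (x / (1 - x)).
  - replace (x / (1 - x)) with (/ (1 - x) - 1) by (field; lra). lra.
  - unfold Rdiv. apply Rmult_le_compat_l; [lra|]. apply Rinv_le_contravar; lra.
Qed.

Lemma AL_cone_estimate (u : R -> Z -> C) (c eps t : R) (n0 : Z) (L : nat) :
  is_AL_solution u -> (forall n, Cmod (u 0 n) < 1) ->
  0 <= c -> 0 < eps -> exp eps - 1 <= c / 2 * eps -> 0 <= t ->
  Cmod (u t n0) ^ 2 <= 2 * sum_f_R0 (fun i =>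
      let n := (n0 - Z.of_nat L + Z.of_nat i)%Z in
      logistic eps (IZR (Z.abs (n - n0)) - c * t) * - ln (1 - Cmod (u 0 n) ^ 2)) (2 * L)
    + 8 * t * exp (- (eps * (INR L - c * t))).
Proof.
  intros Hu H0 Hc He Hk Ht.
  assert (Pos := fun s n Hs => AL_defocusing u s n Hu H0 Hs).
  eapply Rle_trans; [apply neg_ln_ge; specialize (Pos t n0 Ht); lra|].
  (* The current is at most the sum of two squared moduli. These are below 1, and each is below its
     own energy by [x <= - ln (1 - x)], so both flux bounds hold. *)
  apply (cone_energy_estimate (fun s n => - ln (1 - Cmod (u s n) ^ 2))
           (fun s n => bond_current (u s) n) c eps t n0 L); auto.
  - intros s n Hs. pose proof (AL_deficit_derive u s n Hu) as D.
    specialize (Pos s n ltac:(lra)).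
    evar_last.
    + apply (is_derive_opp (K := R_AbsRing) (V := R_NormedModule)).
      apply (is_derive_comp ln); [apply is_derive_ln; exact Pos|exact D].
    + unfold opp, scal, mult; simpl. unfold mult; simpl. field. lra.
  - intros s n Hs. specialize (Pos s n ltac:(lra)).
    pose proof (neg_ln_ge (Cmod (u s n) ^ 2) ltac:(lra)).
    pose proof (pow2_ge_0 (Cmod (u s n))). lra.
  - intros s n Hs. eapply Rle_trans; [apply bond_current_le|].
    apply Rplus_le_compat; apply neg_ln_ge.
    + specialize (Pos s n ltac:(lra)); lra.
    + specialize (Pos s (n + 1)%Z ltac:(lra)); lra.
  - intros s n Hs. eapply Rle_trans; [apply bond_current_le|].
    pose proof (Pos s n ltac:(lra)). pose proof (Pos s (n + 1)%Z ltac:(lra)). lra.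
Qed.

(** * Decay in Region C *)

Definition jap (n : Z) : R := 1 + IZR (Z.abs n).

Lemma jap_ge_1 (n : Z) : 1 <= jap n.
Proof. unfold jap. pose proof (IZR_le 0 (Z.abs n) (Z.abs_nonneg n)). lra. Qed.

Lemma rapidly_decreasing_pow (q : Z -> C) (k : nat) :
  rapidly_decreasing q -> exists K, 0 < K /\ forall n, Cmod (q n) <= K / jap n ^ k.
Proof.
  (* The exponent [S k] is positive even for [k = 0]; the surplus power is given away. *)
  intros H. destruct (H (INR (S k)) (lt_0_INR (S k) ltac:(lia))) as (K & HK & B).
  exists K; split; [exact HK|]. intros n. eapply Rle_trans; [apply B|].
  pose proof (jap_ge_1 n) as J. fold (jap n).
  rewrite Rpower_Ropp, Rpower_pow by lra. apply Rmult_le_compat_l; [lra|].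
  apply Rinv_le_contravar; [apply pow_lt; lra|]. apply Rle_pow; [exact J|lia].
Qed.

(** Outside a finite window the decay gives at most 1/2; inside it a finite maximum of numbers below
    1 is taken. *)
Lemma lt_1_uniform (q : Z -> C) :
  rapidly_decreasing q -> (forall n, Cmod (q n) < 1) ->
  exists s, 0 <= s < 1 /\ forall n, Cmod (q n) <= s.
Proof.
  intros Hq H1. destruct (rapidly_decreasing_pow q 1 Hq) as (K & HK & B).
  assert (fin : forall N : nat, exists s, 0 <= s < 1 /\
            forall n, (Z.abs n <= Z.of_nat N)%Z -> Cmod (q n) <= s).
  { induction N as [|N (s & Hs & IH)].
    - exists (Cmod (q 0%Z)). split; [split; [apply Cmod_ge_0|apply H1]|].
      intros n Hn. replace n with 0%Z by lia. lra.
    - set (m := Z.of_nat (S N)).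
      exists (Rmax s (Rmax (Cmod (q m)) (Cmod (q (- m)%Z)))). split.
      + split; [eapply Rle_trans; [|apply Rmax_l]; lra|].
        repeat apply Rmax_lub_lt; try apply H1; lra.
      + intros n Hn. destruct (Z.eq_dec (Z.abs n) m) as [E|E].
        * eapply Rle_trans; [|apply Rmax_r].
          destruct (Z.abs_eq_or_opp n) as [A|A].
          -- replace n with m at 1 by lia. apply Rmax_l.
          -- replace n with (- m)%Z at 1 by lia. apply Rmax_r.
        * eapply Rle_trans; [|apply Rmax_l]. apply IH. unfold m in E. lia. }
  destruct (INR_unbounded (2 * K)) as [N HN].
  destruct (fin N) as (s & Hs & F). exists (Rmax s (/ 2)). split.
  - split; [eapply Rle_trans; [|apply Rmax_l]; lra|]. apply Rmax_lub_lt; lra.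
  - intros n. destruct (Z_le_gt_dec (Z.abs n) (Z.of_nat N)) as [L|L].
    + eapply Rle_trans; [now apply F|apply Rmax_l].
    + eapply Rle_trans; [|apply Rmax_r]. eapply Rle_trans; [apply B|].
      assert (INR N <= IZR (Z.abs n)) by (rewrite INR_IZR_INZ; apply IZR_le; lia).
      pose proof (jap_ge_1 n). rewrite pow_1.
      apply Rmult_le_reg_r with (jap n); [lra|].
      unfold Rdiv. rewrite Rmult_assoc, Rinv_l by lra. unfold jap. lra.
Qed.

(** A bounded discrete primitive of [/ jap n ^ 2], so that sums are estimated by telescoping. The
    shift 1/2 works because [(x + 1/2) (x + 3/2) <= (x + 1)^2]. *)
Definition jap_primitive (n : Z) : R :=
  if Z_le_gt_dec 0 n then 4 - / (IZR n + / 2) else / (IZR (- n) + / 2).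

Lemma jap_primitive_bounds (n : Z) : 0 <= jap_primitive n <= 4.
Proof.
  unfold jap_primitive. destruct (Z_le_gt_dec 0 n) as [H|H].
  - apply IZR_le in H.
    assert (0 < / (IZR n + / 2) <= 2); [|lra]. split.
    + apply Rinv_0_lt_compat. lra.
    + replace 2 with (/ / 2) at 2 by field. apply Rinv_le_contravar; lra.
  - assert (H' : (1 <= - n)%Z) by lia. apply IZR_le in H'.
    assert (0 < / (IZR (- n) + / 2) <= 2); [|lra]. split.
    + apply Rinv_0_lt_compat. lra.
    + replace 2 with (/ / 2) at 2 by field. apply Rinv_le_contravar; lra.
Qed.

Lemma jap_primitive_step (n : Z) :
  / jap n ^ 2 <= jap_primitive (n + 1) - jap_primitive n.
Proof.
  assert (key : forall x, 0 <= x -> / (1 + x) ^ 2 <= / (x + / 2) - / (x + 1 + / 2)).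
  { intros x Hx.
    replace (/ (x + / 2) - / (x + 1 + / 2)) with (/ ((x + / 2) * (x + 1 + / 2))) by
      (field; lra).
    apply Rinv_le_contravar; nra. }
  unfold jap_primitive, jap.
  destruct (Z_le_gt_dec 0 n) as [H|H]; destruct (Z_le_gt_dec 0 (n + 1)) as [H1|H1]; try lia.
  - rewrite Z.abs_eq, plus_IZR by lia. apply IZR_le in H. specialize (key _ H). lra.
  - replace n with (-1)%Z by lia. simpl. lra.
  - replace (Z.abs n) with (- (n + 1) + 1)%Z by lia.
    replace (- n)%Z with (- (n + 1) + 1)%Z by lia.
    rewrite plus_IZR. assert (H2 : (0 <= - (n + 1))%Z) by lia. apply IZR_le in H2.
    set (x := IZR (- (n + 1))) in *.
    eapply Rle_trans; [|apply key; exact H2].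
    apply Rinv_le_contravar; nra.
Qed.

Lemma sum_jap_le (A : Z) (K : nat) :
  sum_f_R0 (fun i => / jap (A + Z.of_nat i) ^ 2) K <= 4.
Proof.
  assert (T : sum_f_R0 (fun i => / jap (A + Z.of_nat i) ^ 2) K
              <= jap_primitive (A + Z.of_nat K + 1) - jap_primitive A).
  { induction K as [|K IH].
    - cbn [sum_f_R0]. change (Z.of_nat 0) with 0%Z. rewrite !Z.add_0_r. apply jap_primitive_step.
    - cbn [sum_f_R0]. pose proof (jap_primitive_step (A + Z.of_nat (S K))) as S1.
      replace (A + Z.of_nat K + 1)%Z with (A + Z.of_nat (S K))%Z in IH by lia. lra. }
  pose proof (jap_primitive_bounds A). pose proof (jap_primitive_bounds (A + Z.of_nat K + 1)).
  lra.
Qed.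

Lemma exp_le (x y : R) : x <= y -> exp x <= exp y.
Proof. intros [H| ->]; [left; now apply exp_increasing|lra]. Qed.

Lemma le_of_le_plus_exp (x y a b eps : R) :
  0 < eps -> 0 <= a -> (forall L : nat, x <= y + a * exp (- (eps * (INR L - b)))) -> x <= y.
Proof.
  intros He Ha H. apply le_epsilon. intros e Hpos.
  destruct (INR_unbounded (b + a / (e * eps))) as [L HL].
  eapply Rle_trans; [apply H|]. apply Rplus_le_compat_l.
  rewrite exp_Ropp. pose proof (exp_pos (eps * (INR L - b))) as P.
  apply Rmult_le_reg_r with (exp (eps * (INR L - b))); [exact P|].
  rewrite Rmult_assoc, Rinv_l by lra.
  pose proof (exp_ineq1_le (eps * (INR L - b))) as E.
  assert (e * (eps * (a / (e * eps))) = a) by (field; lra).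
  assert (e * (eps * (a / (e * eps))) <= e * (eps * (INR L - b))).
  { apply Rmult_le_compat_l; [lra|]. apply Rmult_le_compat_l; lra. }
  nra.
Qed.

(** The cone has slope [c] strictly between 2 and [2 + V0]. Sites left of [kap * n0] lie outside its
    base by at least [kap * n0], so their weight is exponentially small. To the right the data enter
    through [h], in the summable form [h / jap n ^ 2]. *)
Lemma AL_region_estimate (u : R -> Z -> C) (V0 : R) :
  is_AL_solution u -> rapidly_decreasing (u 0) -> (forall n, Cmod (u 0 n) < 1) -> 0 < V0 ->
  exists gam kap B, 0 < gam /\ 0 < kap /\ 0 < B /\ forall t n0 h,
    0 <= t -> IZR n0 > (2 + V0) * t -> 0 <= h ->
    (forall n, kap * IZR n0 < IZR n -> Cmod (u 0 n) ^ 2 <= h / jap n ^ 2) ->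
    Cmod (u t n0) ^ 2 <= B * (exp (- (gam * IZR n0)) + h).
Proof.
  intros Hu Hd H1 HV.
  destruct (lt_1_uniform _ Hd H1) as (s & Hs & Bs).
  destruct (rapidly_decreasing_pow _ 1 Hd) as (K & HK & BK).
  (* [eps] solves [/ (1 - eps) - 1 = c / 2 * eps], which with [exp eps <= / (1 - eps)] yields the
     smallness condition; [kap] solves [c = (1 - 2 * kap) * (2 + V0)]. *)
  set (eps := V0 / (4 + V0)). set (kap := V0 / (4 * (2 + V0))). set (c := 2 + V0 / 2).
  assert (Heps : 0 < eps) by (apply Rdiv_lt_0_compat; lra).
  assert (Heps1 : 1 - eps = 4 / (4 + V0)) by (unfold eps; field; lra).
  assert (Hkap : 0 < kap) by (apply Rdiv_lt_0_compat; lra).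
  assert (Hk2 : c = (1 - 2 * kap) * (2 + V0)) by (unfold c, kap; field; lra).
  assert (Hk3 : 0 <= 1 - 2 * kap).
  { replace (1 - 2 * kap) with (c / (2 + V0)) by (rewrite Hk2; field; lra).
    apply Rdiv_le_0_compat; unfold c; lra. }
  assert (Hexp : exp eps - 1 <= c / 2 * eps).
  { pose proof (exp_ineq1_le (- eps)) as E. rewrite exp_Ropp in E.
    assert (P : 0 < 1 - eps) by (rewrite Heps1; apply Rdiv_lt_0_compat; lra).
    pose proof (exp_pos eps).
    assert (exp eps <= / (1 - eps)).
    { rewrite <- (Rinv_inv (exp eps)). apply Rinv_le_contravar; lra. }
    replace (c / 2 * eps) with (/ (1 - eps) - 1) by
      (rewrite Heps1; unfold c, eps; field; lra). lra. }
  assert (Hs2 : s ^ 2 < 1) by nra.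
  set (a := / (1 - s ^ 2)).
  assert (Ha : 0 < a) by (apply Rinv_0_lt_compat; lra).
  assert (ln_bound : forall n, 0 <= - ln (1 - Cmod (u 0 n) ^ 2) <= a * Cmod (u 0 n) ^ 2).
  { intros n. pose proof (Cmod_ge_0 (u 0 n)). specialize (Bs n).
    assert (0 <= Cmod (u 0 n) ^ 2 <= s ^ 2) by nra. split.
    - pose proof (neg_ln_ge (Cmod (u 0 n) ^ 2) ltac:(lra)). lra.
    - unfold a. rewrite Rmult_comm. apply neg_ln_le; lra. }
  exists (eps * kap), kap, (8 * a * (K ^ 2 + 1)).
  split; [nra|]. split; [exact Hkap|]. split; [nra|].
  intros t n0 h Ht Hn Hh Hq.
  set (E := exp (- (eps * kap * IZR n0))).
  assert (HE : 0 < E) by apply exp_pos.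
  (* The error from the ends of the sum disappears as [L] tends to infinity, because the bound on
     the sum is uniform in [L]. *)
  apply (le_of_le_plus_exp _ _ (8 * t) (c * t) eps); [exact Heps|lra|]. intros L.
  eapply Rle_trans; [apply (AL_cone_estimate u c eps t n0 L); auto; unfold c; lra|].
  apply Rplus_le_compat_r.
  apply Rle_trans with (2 * (a * (K ^ 2 * E + h) * 4)).
  2:{ assert (0 <= a * K ^ 2 * h) by (repeat apply Rmult_le_pos; try lra; nra).
      assert (0 <= a * E) by nra. nra. }
  apply Rmult_le_compat_l; [lra|].
  apply Rle_trans with (sum_f_R0 (fun i =>
     / jap (n0 - Z.of_nat L + Z.of_nat i) ^ 2 * (a * (K ^ 2 * E + h))) (2 * L)).
  - apply sum_Rle. intros i _. cbv zeta.
    set (n := (n0 - Z.of_nat L + Z.of_nat i)%Z).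
    pose proof (jap_ge_1 n) as J. pose proof (ln_bound n) as [l0 l1].
    assert (Pj : 0 < / jap n ^ 2) by (apply Rinv_0_lt_compat, pow_lt; lra).
    set (x := IZR (Z.abs (n - n0)) - c * t).
    (* Right of the threshold the weight is bounded by 1 and [h] is used; left of it the weight is
       at most [E] and the crude decay [K / jap n] gives summability. *)
    destruct (Rlt_dec (kap * IZR n0) (IZR n)) as [Hf|Hf].
    + specialize (Hq n Hf). unfold Rdiv in Hq.
      apply Rle_trans with (a * Cmod (u 0 n) ^ 2).
      * eapply Rle_trans; [|exact l1]. rewrite <- (Rmult_1_l (- ln _)) at 2.
        apply Rmult_le_compat_r; [exact l0|apply logistic_le_1].
      * apply Rle_trans with (a * (h * / jap n ^ 2)); [apply Rmult_le_compat_l; lra|].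
        assert (0 <= / jap n ^ 2 * (a * (K ^ 2 * E))); [|lra].
        repeat apply Rmult_le_pos; lra.
    + assert (Hx : logistic eps x <= E).
      { eapply Rle_trans; [apply logistic_le_exp|]. apply exp_le. unfold x.
        assert (IZR n0 - IZR n <= IZR (Z.abs (n - n0))).
        { rewrite <- minus_IZR. apply IZR_le. lia. }
        assert (c * t <= (1 - 2 * kap) * IZR n0).
        { rewrite Hk2, Rmult_assoc. apply Rmult_le_compat_l; lra. }
        assert (kap * IZR n0 <= x) by (unfold x; lra). fold x. nra. }
      pose proof (logistic_pos eps x).
      assert (Hqn : Cmod (u 0 n) ^ 2 <= K ^ 2 * / jap n ^ 2).
      { rewrite <- pow_inv, <- Rpow_mult_distr. apply pow_incr.
        split; [apply Cmod_ge_0|]. specialize (BK n). now rewrite pow_1 in BK. }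
      apply Rle_trans with (E * (a * (K ^ 2 * / jap n ^ 2))).
      * apply Rmult_le_compat; [lra|exact l0|exact Hx|].
        eapply Rle_trans; [exact l1|]. apply Rmult_le_compat_l; lra.
      * assert (0 <= / jap n ^ 2 * (a * h)); [|lra].
        repeat apply Rmult_le_pos; lra.
  - rewrite <- scal_sum, Rmult_comm. rewrite (Rmult_comm _ 4).
    apply Rmult_le_compat_r; [|apply sum_jap_le].
    apply Rmult_le_pos; [lra|]. pose proof (pow2_ge_0 K). nra.
Qed.

(** * From the region estimate to polynomial and exponential rates *)

Lemma exp_INR_mult (x : R) (m : nat) : exp (INR m * x) = exp x ^ m.
Proof.
  induction m as [|m IH].
  - now rewrite Rmult_0_l, exp_0.
  - rewrite S_INR, Rmult_plus_distr_r, Rmult_1_l, exp_plus, IH. simpl. ring.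
Qed.

(** The inequality [y <= exp y] at [y = gam * x / m], raised to the power [m]. *)
Lemma exp_neg_le_inv_pow (gam x : R) (m : nat) :
  0 < gam -> 0 < x -> (1 <= m)%nat ->
  exp (- (gam * x)) <= (INR m / gam) ^ m / x ^ m.
Proof.
  intros Hg Hx Hm. pose proof (lt_0_INR m ltac:(lia)) as Pm.
  set (y := gam * x / INR m).
  assert (Hy : 0 < y) by (apply Rdiv_lt_0_compat; nra).
  replace (exp (- (gam * x))) with (/ exp y ^ m).
  2:{ rewrite <- exp_INR_mult, <- exp_Ropp. f_equal. unfold y. field. lra. }
  replace ((INR m / gam) ^ m / x ^ m) with (/ y ^ m).
  - apply Rinv_le_contravar; [now apply pow_lt|]. apply pow_incr.
    pose proof (exp_ineq1_le y). lra.
  - unfold Rdiv. rewrite <- !pow_inv, <- Rpow_mult_distr. f_equal. unfold y. field. lra.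
Qed.

Lemma le_of_sqr_le (x y : R) : 0 <= y -> x ^ 2 <= y ^ 2 -> x <= y.
Proof. intros Hy H. apply Rnot_lt_le. intros L. nra. Qed.

Theorem AL_polynomial_decay (u : R -> Z -> C) (V0 : R) (j : nat) :
  is_AL_solution u -> rapidly_decreasing (u 0) -> (forall n, Cmod (u 0 n) < 1) -> 0 < V0 ->
  (1 <= j)%nat ->
  exists C0 : R, 0 < C0 /\ forall (t : R) (n : Z), 0 <= t -> IZR n > (2 + V0) * t ->
    Cmod (u t n) <= C0 * / (IZR n ^ j).
Proof.
  intros Hu Hd H1 HV Hj.
  destruct (AL_region_estimate u V0 Hu Hd H1 HV) as (gam & kap & B & Hg & Hk & HB & est).
  (* After squaring, order [j + 1] gives [2 * j + 2] powers of [jap m]: two are spent on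
     summability, the others become powers of [n] through [kap * n <= jap m]. *)
  destruct (rapidly_decreasing_pow _ (j + 1) Hd) as (K & HK & BK).
  set (M := (INR (2 * j) / gam) ^ (2 * j)). set (K2 := K ^ 2 / kap ^ (2 * j)).
  assert (HM : 0 < M).
  { apply pow_lt, Rdiv_lt_0_compat; [apply lt_0_INR; lia|exact Hg]. }
  assert (HK2 : 0 < K2) by (apply Rdiv_lt_0_compat; apply pow_lt; lra).
  set (D := B * (M + K2)). assert (HD : 0 < D) by (unfold D; nra).
  exists (sqrt D). split; [now apply sqrt_lt_R0|]. intros t n Ht Hn.
  assert (Pn : 0 < IZR n) by nra.
  set (h := K2 * / IZR n ^ (2 * j)).
  assert (Pp : 0 < / IZR n ^ (2 * j)) by (apply Rinv_0_lt_compat; now apply pow_lt).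
  apply le_of_sqr_le.
  { apply Rmult_le_pos; [apply sqrt_pos|]. left. apply Rinv_0_lt_compat. now apply pow_lt. }
  rewrite Rpow_mult_distr, pow2_sqrt by lra.
  rewrite pow_inv, <- pow_mult, (Nat.mul_comm j 2).
  eapply Rle_trans; [apply (est t n h Ht Hn)|].
  - unfold h. nra.
  - intros m Hm. pose proof (jap_ge_1 m) as J. pose proof (Cmod_ge_0 (u 0 m)) as C0.
    specialize (BK m).
    assert (Jm : kap * IZR n <= jap m).
    { unfold jap. assert (IZR m <= IZR (Z.abs m)) by (apply IZR_le; lia). lra. }
    assert (Pk : 0 < kap * IZR n) by now apply Rmult_lt_0_compat.
    apply Rle_trans with ((K / jap m ^ (j + 1)) ^ 2); [apply pow_incr; lra|].
    unfold Rdiv. rewrite Rpow_mult_distr, pow_inv, <- pow_mult.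
    replace ((j + 1) * 2)%nat with (2 * j + 2)%nat by lia.
    rewrite pow_add, Rinv_mult, <- Rmult_assoc.
    apply Rmult_le_compat_r; [left; apply Rinv_0_lt_compat, pow_lt; lra|].
    unfold h, K2, Rdiv. rewrite Rmult_assoc, <- Rinv_mult, <- Rpow_mult_distr.
    apply Rmult_le_compat_l; [apply pow2_ge_0|].
    apply Rinv_le_contravar; [now apply pow_lt|]. apply pow_incr. lra.
  - pose proof (exp_neg_le_inv_pow gam (IZR n) (2 * j) Hg Pn ltac:(lia)) as E.
    fold M in E. unfold D, h. rewrite Rmult_assoc. apply Rmult_le_compat_l; [lra|].
    unfold Rdiv in E. lra.
Qed.

Theorem AL_exponential_decay (u : R -> Z -> C) (V0 del A : R) :
  is_AL_solution u -> rapidly_decreasing (u 0) -> (forall n, Cmod (u 0 n) < 1) -> 0 < V0 ->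
  0 < del -> 0 < A ->
  (forall n, (0 <= n)%Z -> Cmod (u 0 n) <= A * exp (- (del * IZR n))) ->
  exists rho C0 : R, 0 < rho < 1 /\ 0 < C0 /\
    forall (t : R) (n : Z), 0 <= t -> IZR n > (2 + V0) * t ->
      Cmod (u t n) <= C0 * rho ^ Z.to_nat n.
Proof.
  intros Hu Hd H1 HV Hdel HA Hexp.
  destruct (AL_region_estimate u V0 Hu Hd H1 HV) as (gam & kap & B & Hg & Hk & HB & est).
  destruct (rapidly_decreasing_pow _ 2 Hd) as (K & HK & BK).
  (* The halving accounts for the square root taken at the end: the squared modulus decays at rate
     [2 * b]. *)
  set (b := Rmin gam (del * kap) / 2).
  assert (Hb : 0 < b).
  { unfold b. pose proof (Rmin_pos gam (del * kap) Hg (Rmult_lt_0_compat _ _ Hdel Hk)). lra. }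
  pose proof (Rmin_l gam (del * kap)) as L1. pose proof (Rmin_r gam (del * kap)) as L2.
  assert (HAK : 0 < A * K) by now apply Rmult_lt_0_compat.
  set (D := B * (1 + A * K)).
  assert (HD : 0 < D) by (apply Rmult_lt_0_compat; lra).
  exists (exp (- b)), (sqrt D). split; [|split; [now apply sqrt_lt_R0|]].
  { split; [apply exp_pos|]. rewrite <- exp_0. apply exp_increasing. lra. }
  intros t n Ht Hn. assert (Pn : 0 < IZR n) by nra.
  assert (Zn : (0 < n)%Z) by now apply lt_IZR.
  apply le_of_sqr_le.
  { apply Rmult_le_pos; [apply sqrt_pos|]. apply pow_le. left; apply exp_pos. }
  rewrite Rpow_mult_distr, pow2_sqrt by lra. rewrite <- pow_mult, <- exp_INR_mult.
  replace (INR (Z.to_nat n * 2) * - b) with (- (2 * b * IZR n)).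
  2:{ rewrite mult_INR, (INR_IZR_INZ (Z.to_nat n)), Z2Nat.id by lia. simpl. ring. }
  set (E := exp (- (2 * b * IZR n))).
  eapply Rle_trans; [apply (est t n (A * K * E) Ht Hn)|].
  - left. repeat apply Rmult_lt_0_compat; try lra. apply exp_pos.
  - intros m Hm. assert (Pm : 0 < IZR m) by (assert (0 < kap * IZR n) by nra; lra).
    assert (Zm : (0 < m)%Z) by now apply lt_IZR.
    specialize (Hexp m ltac:(lia)). specialize (BK m). pose proof (Cmod_ge_0 (u 0 m)).
    assert (exp (- (del * IZR m)) <= E).
    { apply exp_le. unfold b.
      assert (Rmin gam (del * kap) * IZR n <= del * kap * IZR n) by
        (apply Rmult_le_compat_r; lra).
      assert (del * (kap * IZR n) <= del * IZR m) by (apply Rmult_le_compat_l; lra).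
      lra. }
    (* One factor supplies the exponential decay, the other the summable weight [/ jap m ^ 2]. *)
    replace (Cmod (u 0 m) ^ 2) with (Cmod (u 0 m) * Cmod (u 0 m)) by ring.
    replace (A * K * E / jap m ^ 2) with (A * E * (K / jap m ^ 2)) by (unfold Rdiv; ring).
    apply Rmult_le_compat; auto. eapply Rle_trans; [exact Hexp|].
    apply Rmult_le_compat_l; lra.
  - assert (exp (- (gam * IZR n)) <= E) by (apply exp_le; unfold b; nra).
    unfold D. rewrite (Rmult_assoc B). apply Rmult_le_compat_l; [lra|].
    lra.
Qed.

(** * Scattering columns *)

(** The Ablowitz-Ladik recursion for the first column, written in the variable
    [z = zeta^-2] with the power [zeta^(2n+1)] removed from the second entry. *)
Fixpoint schur (q : Z -> C) (m : Z) (k : nat) (x0 y0 z : C) : C * C :=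
  match k with
  | O => (x0, y0)
  | S k =>
      let p := schur q m k x0 y0 z in
      let n := (m + Z.of_nat k)%Z in
      (fst p + Cconj (q n) * snd p, z * (snd p + q n * fst p))%C
  end.

Fixpoint upper_prod (q : Z -> C) (m : Z) (k : nat) : R :=
  match k with
  | O => 1
  | S k => upper_prod q m k * (1 + Cmod (q (m + Z.of_nat k)%Z))
  end.

Fixpoint lower_prod (q : Z -> C) (m : Z) (k : nat) : R :=
  match k with
  | O => 1
  | S k => lower_prod q m k * (1 - Cmod (q (m + Z.of_nat k)%Z))
  end.

Lemma upper_prod_ge_1 (q : Z -> C) (m : Z) (k : nat) : 1 <= upper_prod q m k.
Proof.
  induction k as [|k IH]; simpl; [lra|].
  pose proof (Cmod_ge_0 (q (m + Z.of_nat k)%Z)). nra.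
Qed.

Lemma lower_prod_pos (q : Z -> C) (m : Z) (k : nat) :
  (forall n, Cmod (q n) < 1) -> 0 < lower_prod q m k.
Proof.
  intros Hq. induction k as [|k IH]; simpl; [lra|].
  apply Rmult_lt_0_compat; [exact IH|]. specialize (Hq (m + Z.of_nat k)%Z). lra.
Qed.

Lemma Cmod_plus_mult_le (x p y : C) : Cmod (x + p * y) <= Cmod x + Cmod p * Cmod y.
Proof. eapply Rle_trans; [apply Cmod_triangle|]. rewrite Cmod_mult. lra. Qed.

Lemma schur_bound (q : Z -> C) (m : Z) (k : nat) (x0 y0 z : C) :
  Cmod z <= 1 ->
  let p := schur q m k x0 y0 z in
  Cmod (fst p) + Cmod (snd p) <= upper_prod q m k * (Cmod x0 + Cmod y0).
Proof.
  intros Hz. cbv zeta. induction k as [|k IH]; simpl; [lra|].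
  set (p := schur q m k x0 y0 z) in *. set (c := q (m + Z.of_nat k)%Z).
  pose proof (Cmod_plus_mult_le (fst p) (Cconj c) (snd p)) as T1.
  pose proof (Cmod_plus_mult_le (snd p) c (fst p)) as T2.
  rewrite Cmod_conj in T1. rewrite Cmod_mult.
  pose proof (Cmod_ge_0 (snd p + c * fst p)). pose proof (Cmod_ge_0 c).
  pose proof (Cmod_ge_0 z).
  assert (Cmod z * Cmod (snd p + c * fst p) <= Cmod (snd p + c * fst p)) by nra.
  apply Rle_trans with ((Cmod (fst p) + Cmod (snd p)) * (1 + Cmod c)); [nra|].
  replace (upper_prod q m k * (1 + Cmod c) * (Cmod x0 + Cmod y0))
    with (upper_prod q m k * (Cmod x0 + Cmod y0) * (1 + Cmod c)) by ring.
  apply Rmult_le_compat_r; lra.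
Qed.

(** Each step multiplies the second entry by [z], so it vanishes at [z = 0], that is at
    [zeta = infinity]. With no step at all this requires [y0 = 0]. *)
Lemma schur_snd_bound (q : Z -> C) (m : Z) (k : nat) (x0 y0 z : C) :
  Cmod z <= 1 -> (k = O -> y0 = 0) ->
  Cmod (snd (schur q m k x0 y0 z)) <= Cmod z * (upper_prod q m k * (Cmod x0 + Cmod y0)).
Proof.
  intros Hz H0. destruct k as [|k].
  - simpl. rewrite (H0 eq_refl), Cmod_0. pose proof (Cmod_ge_0 z). pose proof (Cmod_ge_0 x0).
    nra.
  - pose proof (schur_bound q m k x0 y0 z Hz) as B. cbv zeta in B. simpl.
    set (p := schur q m k x0 y0 z) in *. set (c := q (m + Z.of_nat k)%Z).
    rewrite Cmod_mult. apply Rmult_le_compat_l; [apply Cmod_ge_0|].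
    pose proof (Cmod_plus_mult_le (snd p) c (fst p)) as T2.
    pose proof (Cmod_ge_0 c). pose proof (Cmod_ge_0 (fst p)). pose proof (Cmod_ge_0 (snd p)).
    apply Rle_trans with ((Cmod (fst p) + Cmod (snd p)) * (1 + Cmod c)); [nra|].
    replace (upper_prod q m k * (1 + Cmod c) * (Cmod x0 + Cmod y0))
      with (upper_prod q m k * (Cmod x0 + Cmod y0) * (1 + Cmod c)) by ring.
    apply Rmult_le_compat_r; lra.
Qed.

(* |x + conj c y|^2 - |y + c x|^2 = (1 - |c|^2) (|x|^2 - |y|^2). *)
Lemma schur_contractive (c x y : C) :
  Cmod c < 1 -> Cmod y <= Cmod x -> Cmod (y + c * x) <= Cmod (x + Cconj c * y).
Proof.
  intros Hc Hxy. apply le_of_sqr_le; [apply Cmod_ge_0|].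
  pose proof (Cmod_ge_0 c) as C0. pose proof (Cmod_ge_0 y) as Y0.
  assert (Cmod y ^ 2 <= Cmod x ^ 2) by (apply pow_incr; lra).
  assert (Cmod c ^ 2 < 1) by nra.
  rewrite !Cmod_sqr in *. destruct c as [c1 c2], x as [x1 x2], y as [y1 y2]; simpl in *.
  nra.
Qed.

(** The second entry stays dominated by the first, so a step shrinks the first by at most
    [1 - Cmod c]. Hence the continued coefficient [A] has no zeros on or outside the circle and may
    be divided by. *)
Lemma schur_lower (q : Z -> C) (m : Z) (k : nat) (z : C) :
  Cmod z <= 1 -> (forall n, Cmod (q n) < 1) ->
  let p := schur q m k 1 0 z in
  Cmod (snd p) <= Cmod (fst p) /\ lower_prod q m k <= Cmod (fst p).
Proof.
  intros Hz Hq. cbv zeta. induction k as [|k [IH1 IH2]]; simpl.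
  - rewrite Cmod_0, Cmod_1. lra.
  - set (p := schur q m k 1 0 z) in *. set (c := q (m + Z.of_nat k)%Z).
    specialize (Hq (m + Z.of_nat k)%Z). fold c in Hq.
    pose proof (schur_contractive c (fst p) (snd p) Hq IH1) as T.
    pose proof (Cmod_ge_0 (snd p + c * fst p)). pose proof (Cmod_ge_0 z).
    pose proof (Cmod_ge_0 c). pose proof (Cmod_ge_0 (fst p)).
    rewrite Cmod_mult. split; [nra|].
    pose proof (Cmod_plus_mult_le (fst p + Cconj c * snd p) (- Cconj c) (snd p)) as T2.
    rewrite Cmod_opp, Cmod_conj in T2.
    replace (fst p + Cconj c * snd p + - Cconj c * snd p)%C with (fst p) in T2 by ring.
    apply Rle_trans with (Cmod (fst p) * (1 - Cmod c)); [apply Rmult_le_compat_r; lra|].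
    nra.
Qed.

(** The first step produces [Cconj (q m)]; later steps add multiples of the second entry, which is
    of order [z]. Applied to conjugated data, this recovers the potential as a value at the
    centre. *)
Lemma schur_fst_near_0 (q : Z -> C) (m : Z) (k : nat) :
  exists K, 0 <= K /\ forall z, Cmod z <= 1 ->
    Cmod (fst (schur q m (S k) 0 1 z) - Cconj (q m)) <= K * Cmod z.
Proof.
  induction k as [|k (K & HK & IH)].
  - exists 0; split; [lra|]. intros z _. simpl. rewrite Z.add_0_r.
    replace (0 + Cconj (q m) * 1 - Cconj (q m))%C with (RtoC 0) by ring.
    rewrite Cmod_0. lra.
  - set (n := (m + Z.of_nat (S k))%Z).
    exists (K + Cmod (q n) * (upper_prod q m (S k) * (Cmod 0 + Cmod 1))).
    pose proof (Cmod_ge_0 (q n)) as Q0. pose proof (upper_prod_ge_1 q m (S k)) as U1.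
    rewrite Cmod_0, Cmod_1. split; [nra|]. intros z Hz.
    specialize (IH z Hz).
    pose proof (schur_snd_bound q m (S k) 0 1 z Hz ltac:(discriminate)) as B.
    rewrite Cmod_0, Cmod_1 in B.
    change (schur q m (S (S k)) 0 1 z) with
      (fst (schur q m (S k) 0 1 z) + Cconj (q n) * snd (schur q m (S k) 0 1 z),
       z * (snd (schur q m (S k) 0 1 z) + q n * fst (schur q m (S k) 0 1 z)))%C.
    cbn [fst].
    set (p := schur q m (S k) 0 1 z) in *.
    replace (fst p + Cconj (q n) * snd p - Cconj (q m))%C
      with (fst p - Cconj (q m) + Cconj (q n) * snd p)%C by ring.
    eapply Rle_trans; [apply Cmod_plus_mult_le|]. rewrite Cmod_conj.
    assert (Cmod (q n) * Cmod (snd p)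
            <= Cmod (q n) * (Cmod z * (upper_prod q m (S k) * (0 + 1)))) by
      (apply Rmult_le_compat_l; lra).
    lra.
Qed.

Lemma schur_holomorphic (q : Z -> C) (m : Z) (k : nat) (x0 y0 : C) (f : C -> C) (w : C) :
  holomorphic_at f w ->
  holomorphic_at (fun v => fst (schur q m k x0 y0 (f v))) w /\
  holomorphic_at (fun v => snd (schur q m k x0 y0 (f v))) w.
Proof.
  intros Hf. induction k as [|k [IH1 IH2]]; simpl.
  - split; apply holomorphic_const.
  - split.
    + apply holomorphic_plus; [exact IH1|].
      apply holomorphic_mult; [apply holomorphic_const|exact IH2].
    + apply holomorphic_mult; [exact Hf|]. apply holomorphic_plus; [exact IH2|].
      apply holomorphic_mult; [apply holomorphic_const|exact IH1].
Qed.

(** On the unit circle a product of steps has the form [[a, conj b], [b, conj a]] and is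
    determined by its first column; [om n] stands for [zeta^(2n+1)]. *)
Fixpoint column (q om : Z -> C) (m : Z) (k : nat) : C * C :=
  match k with
  | O => (RtoC 1, RtoC 0)
  | S k =>
      let p := column q om m k in
      let n := (m + Z.of_nat k)%Z in
      (fst p + Cconj (q n) * Cconj (om n) * snd p, snd p + q n * om n * fst p)%C
  end.

(** Multiplication of transfer matrices, the later factor on the left, expressed through first
    columns. *)
Lemma column_app (q om : Z -> C) (m : Z) (k1 k2 : nat) :
  let L := column q om m k1 in
  let R := column q om (m + Z.of_nat k1) k2 in
  column q om m (k1 + k2) =
    (fst R * fst L + Cconj (snd R) * snd L, snd R * fst L + Cconj (fst R) * snd L)%C.
Proof.
  cbv zeta. induction k2 as [|k2 IH].
  - rewrite Nat.add_0_r. simpl. destruct (column q om m k1) as [a b]; simpl.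
    replace (Cconj 0) with (RtoC 0) by (unfold Cconj, RtoC; simpl; f_equal; ring).
    replace (Cconj 1) with (RtoC 1) by (unfold Cconj, RtoC; simpl; f_equal; ring).
    f_equal; ring.
  - rewrite Nat.add_succ_r. cbn [column]. rewrite IH. cbn [fst snd].
    replace (m + Z.of_nat (k1 + k2))%Z with (m + Z.of_nat k1 + Z.of_nat k2)%Z by lia.
    rewrite !Cplus_conj, !Cmult_conj, !Cconj_conj. f_equal; ring.
Qed.

Lemma column_near_id (q om : Z -> C) (m : Z) (k : nat) :
  (forall n, Cmod (om n) = 1) ->
  Cmod (fst (column q om m k) - 1) + Cmod (snd (column q om m k)) <= upper_prod q m k - 1.
Proof.
  intros Hom. induction k as [|k IH]; simpl.
  - replace (1 - 1)%C with (RtoC 0) by ring. rewrite Cmod_0. lra.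
  - set (p := column q om m k) in *. set (n := (m + Z.of_nat k)%Z).
    pose proof (Cmod_plus_mult_le (fst p - 1) (Cconj (q n) * Cconj (om n)) (snd p)) as T1.
    pose proof (Cmod_plus_mult_le (snd p) (q n * om n) (fst p)) as T2.
    rewrite Cmod_mult, !Cmod_conj, Hom in T1. rewrite Cmod_mult, Hom in T2.
    replace (fst p + Cconj (q n) * Cconj (om n) * snd p - 1)%C
      with (fst p - 1 + Cconj (q n) * Cconj (om n) * snd p)%C by ring.
    pose proof (Cmod_triangle_minus (fst p) 1) as T3. rewrite Cmod_1 in T3.
    pose proof (Cmod_ge_0 (q n)).
    assert (Cmod (q n) * (Cmod (fst p) + Cmod (snd p)) <= Cmod (q n) * upper_prod q m k) by
      (apply Rmult_le_compat_l; lra).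
    lra.
Qed.

Lemma column_bound (q om : Z -> C) (m : Z) (k : nat) :
  (forall n, Cmod (om n) = 1) ->
  Cmod (fst (column q om m k)) + Cmod (snd (column q om m k)) <= upper_prod q m k.
Proof.
  intros Hom. pose proof (column_near_id q om m k Hom).
  pose proof (Cmod_triangle_minus (fst (column q om m k)) 1) as T. rewrite Cmod_1 in T. lra.
Qed.

Lemma Cmult_conj_unit (z : C) : Cmod z = 1 -> (z * Cconj z = 1)%C.
Proof.
  intros H. rewrite <- Cmod2_conj, H. unfold RtoC, Cpow, Cmult. simpl. f_equal; ring.
Qed.

(** The determinant of a product of steps on the circle. It is independent of [zeta], so it acts as
    a constant when contours are moved. *)
Fixpoint det_prod (q : Z -> C) (m : Z) (k : nat) : C :=
  match k with
  | O => 1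
  | S k => let c := q (m + Z.of_nat k)%Z in (det_prod q m k * (1 - c * Cconj c))%C
  end.

Lemma column_det (q om : Z -> C) (m : Z) (k : nat) :
  (forall n, Cmod (om n) = 1) ->
  let p := column q om m k in
  (fst p * Cconj (fst p) - snd p * Cconj (snd p) = det_prod q m k)%C.
Proof.
  intros Hom. cbv zeta. induction k as [|k IH].
  - simpl. unfold Cconj, RtoC; simpl.
    unfold Cmult, Cminus, Cplus, Copp; simpl; f_equal; ring.
  - cbn [column det_prod fst snd]. rewrite <- IH.
    set (n := (m + Z.of_nat k)%Z).
    rewrite !Cplus_conj, !Cmult_conj, !Cconj_conj.
    pose proof (Cmult_conj_unit (om n) (Hom n)) as U.
    set (p := column q om m k). set (a := fst p). set (b := snd p).
    set (c := q n). set (o := om n) in *.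
    transitivity ((a * Cconj a - b * Cconj b) * (1 - c * Cconj c * (o * Cconj o)))%C; [ring|].
    rewrite U. ring.
Qed.

(** Here [z] plays the role of [zeta^-2]. The right-hand side is polynomial in [z] up to the
    explicit power, which continues the column to the outside of the circle. *)
Lemma column_schur (q om : Z -> C) (z : C) (m : Z) (k : nat) :
  (forall n, Cmod (om n) = 1) -> (forall n, om n = om (n + 1)%Z * z)%C ->
  column q om m k = (fst (schur q m k 1 0 z),
                     om (m + Z.of_nat k)%Z * snd (schur q m k 1 0 z))%C.
Proof.
  intros Hom Hz. induction k as [|k IH].
  - simpl. f_equal. ring.
  - cbn [column schur]. rewrite IH. cbn [fst snd].
    replace (m + Z.of_nat (S k))%Z with (m + Z.of_nat k + 1)%Z by lia.
    set (n := (m + Z.of_nat k)%Z). pose proof (Cmult_conj_unit (om n) (Hom n)) as U.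
    set (p := schur q m k 1 0 z). f_equal.
    + transitivity (fst p + Cconj (q n) * (om n * Cconj (om n)) * snd p)%C; [ring|].
      rewrite U. ring.
    + rewrite (Hz n). ring.
Qed.

(** Now [z] is [zeta^2]. With its entries exchanged the column obeys the same recursion for
    conjugated data, so the second entry, divided by [om m], continues to the inside. *)
Lemma column_schur_reversed (q om : Z -> C) (z : C) (m : Z) (k : nat) :
  (forall n, Cmod (om n) = 1) -> (forall n, om (n + 1)%Z = om n * z)%C ->
  let p := schur (fun n => Cconj (q n)) m k 0 1 z in
  (snd (column q om m k) = om m * fst p /\
   om (m + Z.of_nat k)%Z * fst (column q om m k) = om m * snd p)%C.
Proof.
  intros Hom Hz. cbv zeta. induction k as [|k [IH1 IH2]].
  - simpl. rewrite Z.add_0_r. split; ring.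
  - cbn [column schur fst snd].
    replace (m + Z.of_nat (S k))%Z with (m + Z.of_nat k + 1)%Z by lia.
    set (n := (m + Z.of_nat k)%Z) in *. pose proof (Cmult_conj_unit (om n) (Hom n)) as U.
    rewrite Cconj_conj.
    set (p := schur (fun n => Cconj (q n)) m k 0 1 z) in *.
    set (c := column q om m k) in *. split.
    + transitivity (snd c + q n * (om n * fst c))%C; [ring|]. rewrite IH1, IH2. ring.
    + rewrite Hz.
      transitivity (z * (om n * fst c) + z * (om n * Cconj (om n)) * Cconj (q n) * snd c)%C;
        [ring|].
      rewrite U, IH1, IH2. ring.
Qed.

(** * Convergence of the finite windows *)

Lemma Cpown_cexp (w : C) (k : nat) : Cpown (cexp w) k = cexp (RtoC (INR k) * w).
Proof.
  induction k as [|k IH].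
  - simpl. rewrite Cmult_0_l, cexp_0. reflexivity.
  - rewrite S_INR, RtoC_plus, Cmult_plus_distr_r, Cmult_1_l, cexp_plus, <- IH.
    simpl. ring.
Qed.

Lemma Cpowz_cexp (w : C) (n : Z) : Cpowz (cexp w) n = cexp (RtoC (IZR n) * w).
Proof.
  destruct n as [|p|p]; simpl.
  - rewrite Cmult_0_l, cexp_0. reflexivity.
  - rewrite Cpown_cexp, INR_IZR_INZ, positive_nat_Z. reflexivity.
  - rewrite Cpown_cexp, INR_IZR_INZ, positive_nat_Z, <- cexp_opp. f_equal.
    change (Z.neg p) with (- Z.pos p)%Z. rewrite opp_IZR, RtoC_opp. ring.
Qed.

Lemma cexp_IZR_periodic (n : Z) (x : R) :
  cexp (RtoC (IZR n) * (x, 0)) = cexp (RtoC (IZR n) * (x, 2 * PI)).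
Proof.
  rewrite <- !Cpowz_cexp. f_equal. unfold cexp; simpl.
  now rewrite cos_0, sin_0, cos_2PI, sin_2PI.
Qed.

Lemma Cmod_cexp_IZR (n : Z) (x y : R) :
  Cmod (cexp (RtoC (IZR n) * (x, y))) = exp (IZR n * x).
Proof. rewrite Cmod_cexp. f_equal. simpl. ring. Qed.

Definition circle_power (y : R) (n : Z) : C := cexp (RtoC (IZR (2 * n + 1)) * (0, y)).

Lemma Cmod_circle_power (y : R) (n : Z) : Cmod (circle_power y n) = 1.
Proof. unfold circle_power. now rewrite Cmod_cexp_IZR, Rmult_0_r, exp_0. Qed.

Lemma circle_power_shift (y : R) (n k : Z) :
  circle_power y (n + k)%Z = (circle_power y n * cexp (RtoC (IZR (2 * k)) * (0, y)))%C.
Proof.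
  unfold circle_power. rewrite <- cexp_plus. f_equal.
  rewrite <- Cmult_plus_distr_r, <- RtoC_plus, <- plus_IZR. do 3 f_equal. lia.
Qed.

Lemma Cconj_cexp (w : C) : Cconj (cexp w) = cexp (Cconj w).
Proof. unfold cexp, Cconj; simpl. rewrite cos_neg, sin_neg. f_equal. ring. Qed.

(** On the circle the negative power in [AL_step] is the conjugate of the positive one, which links
    the defining product to [column]. *)
Lemma AL_prod_column (q : Z -> C) (y : R) (m : Z) (k : nat) :
  let A := AL_prod q (cexp (0, y)) m k in
  (m11 A, m21 A) = column q (circle_power y) m k.
Proof.
  cbv zeta. induction k as [|k IH]; [reflexivity|].
  cbn [AL_prod column]. rewrite <- IH. set (n := (m + Z.of_nat k)%Z).
  unfold mat2_mul, AL_step. cbn [m11 m12 m21 m22].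
  rewrite !Cpowz_cexp. fold (circle_power y n).
  replace (cexp (RtoC (IZR (- (2 * n + 1))) * (0, y))) with (Cconj (circle_power y n)).
  - cbn [fst snd]. f_equal; ring.
  - unfold circle_power. rewrite Cconj_cexp. f_equal.
    rewrite opp_IZR. unfold Cconj, Cmult, RtoC; simpl. f_equal; ring.
Qed.

Lemma upper_prod_le (q : Z -> C) (K : R) (m : Z) (k : nat) :
  0 <= K -> (forall n, Cmod (q n) <= K / jap n ^ 2) ->
  upper_prod q m k <= exp (K * (jap_primitive (m + Z.of_nat k) - jap_primitive m)).
Proof.
  intros HK Hq. induction k as [|k IH]; cbn [upper_prod].
  - rewrite Z.add_0_r, Rminus_diag, Rmult_0_r, exp_0. lra.
  - set (n := (m + Z.of_nat k)%Z) in *.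
    replace (m + Z.of_nat (S k))%Z with (n + 1)%Z by (unfold n; lia).
    replace (K * (jap_primitive (n + 1) - jap_primitive m)) with
      (K * (jap_primitive n - jap_primitive m) + K * (jap_primitive (n + 1) - jap_primitive n))
      by ring.
    rewrite exp_plus. pose proof (upper_prod_ge_1 q m k). pose proof (Cmod_ge_0 (q n)).
    apply Rmult_le_compat; try lra.
    eapply Rle_trans; [apply exp_ineq1_le|]. apply exp_le.
    eapply Rle_trans; [apply Hq|]. apply Rmult_le_compat_l; [lra|].
    apply jap_primitive_step.
Qed.

Lemma lower_prod_ge (q : Z -> C) (K s : R) (m : Z) (k : nat) :
  0 <= K -> s < 1 -> (forall n, Cmod (q n) <= K / jap n ^ 2) -> (forall n, Cmod (q n) <= s) ->
  exp (- (K / (1 - s) * (jap_primitive (m + Z.of_nat k) - jap_primitive m)))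
  <= lower_prod q m k.
Proof.
  intros HK Hs Hq Hq1. induction k as [|k IH]; cbn [lower_prod].
  - rewrite Z.add_0_r, Rminus_diag, Rmult_0_r, Ropp_0, exp_0. lra.
  - set (n := (m + Z.of_nat k)%Z) in *.
    replace (m + Z.of_nat (S k))%Z with (n + 1)%Z by (unfold n; lia).
    replace (- (K / (1 - s) * (jap_primitive (n + 1) - jap_primitive m))) with
      (- (K / (1 - s) * (jap_primitive n - jap_primitive m)) +
       - (K / (1 - s) * (jap_primitive (n + 1) - jap_primitive n)))
      by ring.
    rewrite exp_plus. specialize (Hq n). specialize (Hq1 n).
    pose proof (Cmod_ge_0 (q n)) as C0.
    apply Rmult_le_compat; [left; apply exp_pos|left; apply exp_pos|exact IH|].
    (* The uniform bound [s < 1] gives [- ln (1 - x) <= x / (1 - s)], after which the sum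
       telescopes. *)
    rewrite <- (exp_ln (1 - Cmod (q n))) by lra. apply exp_le.
    pose proof (neg_ln_le (Cmod (q n)) s C0 Hq1 Hs) as L.
    assert (P : 0 < / (1 - s)) by (apply Rinv_0_lt_compat; lra).
    assert (Cmod (q n) / (1 - s)
            <= K / (1 - s) * (jap_primitive (n + 1) - jap_primitive n)); [|lra].
    unfold Rdiv. rewrite (Rmult_comm K), Rmult_assoc, Rmult_comm.
    apply Rmult_le_compat_l; [lra|]. eapply Rle_trans; [exact Hq|].
    apply Rmult_le_compat_l; [lra|]. apply jap_primitive_step.
Qed.

Lemma upper_prod_bounded (q : Z -> C) :
  rapidly_decreasing q -> exists P, 1 <= P /\ forall m k, upper_prod q m k <= P.
Proof.
  intros Hq. destruct (rapidly_decreasing_pow q 2 Hq) as (K & HK & B).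
  exists (exp (K * 4)). split; [rewrite <- exp_0; apply exp_le; lra|]. intros m k.
  eapply Rle_trans; [apply (upper_prod_le q K m k); auto; lra|]. apply exp_le.
  pose proof (jap_primitive_bounds m). pose proof (jap_primitive_bounds (m + Z.of_nat k)).
  apply Rmult_le_compat_l; lra.
Qed.

Lemma lower_prod_bounded (q : Z -> C) :
  rapidly_decreasing q -> (forall n, Cmod (q n) < 1) ->
  exists c, 0 < c /\ forall m k, c <= lower_prod q m k.
Proof.
  intros Hq H1. destruct (rapidly_decreasing_pow q 2 Hq) as (K & HK & B).
  destruct (lt_1_uniform q Hq H1) as (s & Hs & Bs).
  exists (exp (- (K / (1 - s) * 4))). split; [apply exp_pos|]. intros m k.
  eapply Rle_trans; [|apply (lower_prod_ge q K s m k); auto; lra]. apply exp_le.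
  pose proof (jap_primitive_bounds m). pose proof (jap_primitive_bounds (m + Z.of_nat k)).
  apply Ropp_le_contravar, Rmult_le_compat_l; [|lra]. apply Rdiv_le_0_compat; lra.
Qed.

Lemma upper_prod_tail (q : Z -> C) (tau : R) :
  rapidly_decreasing q -> 0 < tau ->
  exists M0 : nat, forall M d : nat, (M0 <= M)%nat ->
    upper_prod q (Z.of_nat M) d - 1 <= tau /\
    upper_prod q (- Z.of_nat (d + M)) d - 1 <= tau.
Proof.
  intros Hq Ht. destruct (rapidly_decreasing_pow q 2 Hq) as (K & HK & B).
  assert (Hl : 0 < ln (1 + tau)) by (rewrite <- ln_1; apply ln_increasing; lra).
  destruct (INR_unbounded (K / ln (1 + tau))) as [M0 HM0].
  exists M0. intros M d HM. apply le_INR in HM.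
  set (x := INR M) in *. assert (Hx : 0 <= x) by apply pos_INR.
  assert (small : K * / (x + / 2) <= ln (1 + tau)).
  { apply Rmult_le_reg_r with (x + / 2); [lra|].
    rewrite Rmult_assoc, Rinv_l, Rmult_1_r by lra.
    apply Rle_trans with (ln (1 + tau) * (K / ln (1 + tau))); [right; field; lra|].
    apply Rmult_le_compat_l; lra. }
  assert (fin : forall m k, jap_primitive (m + Z.of_nat k) - jap_primitive m <= / (x + / 2) ->
            upper_prod q m k - 1 <= tau).
  { intros m k Hm. pose proof (upper_prod_le q K m k ltac:(lra) B) as U.
    assert (exp (K * (jap_primitive (m + Z.of_nat k) - jap_primitive m)) <= 1 + tau).
    { rewrite <- (exp_ln (1 + tau)) by lra. apply exp_le.
      eapply Rle_trans; [|exact small]. apply Rmult_le_compat_l; lra. }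
    lra. }
  split; apply fin.
  - pose proof (jap_primitive_bounds (Z.of_nat M + Z.of_nat d)).
    replace (jap_primitive (Z.of_nat M)) with (4 - / (x + / 2)); [lra|].
    unfold jap_primitive. destruct Z_le_gt_dec; [|lia].
    unfold x. now rewrite INR_IZR_INZ.
  - replace (- Z.of_nat (d + M) + Z.of_nat d)%Z with (- Z.of_nat M)%Z by lia.
    pose proof (jap_primitive_bounds (- Z.of_nat (d + M))).
    assert (jap_primitive (- Z.of_nat M) <= / (x + / 2)); [|lra].
    (* The nonnegative branch occurs only for [M = 0], where both formulas for the primitive have
       the value 2. *)
    unfold jap_primitive, x. rewrite INR_IZR_INZ. destruct Z_le_gt_dec.
    + replace M with O by lia. simpl. lra.
    + rewrite Z.opp_involutive. lra.
Qed.

Definition window (q : Z -> C) (y : R) (M : nat) : C * C :=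
  column q (circle_power y) (- Z.of_nat M) (2 * M).

Lemma column_window_lower (q : Z -> C) (y : R) (m : Z) (k : nat) :
  (forall n, Cmod (q n) < 1) -> lower_prod q m k <= Cmod (fst (column q (circle_power y) m k)).
Proof.
  intros Hq. rewrite (column_schur q _ (cexp (RtoC (IZR (-2)) * (0, y)))).
  - cbn [fst]. apply schur_lower; auto.
    rewrite Cmod_cexp_IZR, Rmult_0_r, exp_0. lra.
  - apply Cmod_circle_power.
  - intros n. change (-2)%Z with (2 * -1)%Z. rewrite <- circle_power_shift. f_equal; lia.
Qed.

(** The larger window is the smaller one multiplied on both sides by tails close to the identity.
    The bound does not involve [y], which later turns pointwise limits into uniform ones. *)
Lemma window_cauchy (q : Z -> C) (y P tau : R) (M d : nat) :
  (forall m k, upper_prod q m k <= P) ->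
  upper_prod q (Z.of_nat M) d - 1 <= tau ->
  upper_prod q (- Z.of_nat (d + M)) d - 1 <= tau ->
  Cmod (fst (window q y (d + M)) - fst (window q y M)) <= 2 * P * tau /\
  Cmod (snd (window q y (d + M)) - snd (window q y M)) <= 2 * P * tau.
Proof.
  intros HP T1 T2. unfold window. set (om := circle_power y).
  assert (Hom : forall n, Cmod (om n) = 1) by apply Cmod_circle_power.
  replace (2 * (d + M))%nat with ((d + 2 * M) + d)%nat by lia.
  rewrite column_app, column_app. cbn [fst snd].
  replace (- Z.of_nat (d + M) + Z.of_nat d)%Z with (- Z.of_nat M)%Z by lia.
  replace (- Z.of_nat (d + M) + Z.of_nat (d + 2 * M))%Z with (Z.of_nat M) by lia.
  pose proof (column_near_id q om (- Z.of_nat (d + M)) d Hom) as NL.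
  pose proof (column_near_id q om (Z.of_nat M) d Hom) as NR.
  pose proof (column_bound q om (- Z.of_nat M) (2 * M) Hom) as BV.
  pose proof (HP (- Z.of_nat M)%Z (2 * M)%nat) as PV.
  pose proof (column_bound q om (- Z.of_nat (d + M)) (d + 2 * M) Hom) as BW.
  pose proof (HP (- Z.of_nat (d + M))%Z (d + 2 * M)%nat) as PW.
  rewrite column_app in BW. cbn [fst snd] in BW.
  replace (- Z.of_nat (d + M) + Z.of_nat d)%Z with (- Z.of_nat M)%Z in BW by lia.
  set (L := column q om (- Z.of_nat (d + M)) d) in *.
  set (R := column q om (Z.of_nat M) d) in *.
  set (V := column q om (- Z.of_nat M) (2 * M)) in *.
  set (W1 := (fst V * fst L + Cconj (snd V) * snd L)%C) in *.
  set (W2 := (snd V * fst L + Cconj (fst V) * snd L)%C) in *.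
  pose proof (Cmod_ge_0 (fst L - 1)). pose proof (Cmod_ge_0 (snd L)).
  pose proof (Cmod_ge_0 (fst R - 1)). pose proof (Cmod_ge_0 (snd R)).
  pose proof (Cmod_ge_0 (fst V)). pose proof (Cmod_ge_0 (snd V)).
  pose proof (Cmod_ge_0 W1). pose proof (Cmod_ge_0 W2).
  assert (key : forall a b c d, Cmod a + Cmod b <= P -> Cmod c + Cmod d <= tau ->
            Cmod (a * c + b * d) <= P * tau).
  { intros a b c e Hab Hce. eapply Rle_trans; [apply Cmod_triangle|].
    rewrite !Cmod_mult.
    pose proof (Cmod_ge_0 a). pose proof (Cmod_ge_0 b).
    pose proof (Cmod_ge_0 c). pose proof (Cmod_ge_0 e).
    apply Rle_trans with ((Cmod a + Cmod b) * (Cmod c + Cmod e)); [nra|].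
    apply Rmult_le_compat; lra. }
  split.
  - replace (fst R * W1 + Cconj (snd R) * W2 - fst V)%C with
      ((W1 * (fst R - 1) + W2 * Cconj (snd R)) +
       (fst V * (fst L - 1) + Cconj (snd V) * snd L))%C by (unfold W1; ring).
    eapply Rle_trans; [apply Cmod_triangle|].
    assert (K1 : Cmod (W1 * (fst R - 1) + W2 * Cconj (snd R)) <= P * tau) by
      (apply key; rewrite ?Cmod_conj; lra).
    assert (K2 : Cmod (fst V * (fst L - 1) + Cconj (snd V) * snd L) <= P * tau) by
      (apply key; rewrite ?Cmod_conj; lra).
    lra.
  - replace (snd R * W1 + Cconj (fst R) * W2 - snd V)%C with
      ((W1 * snd R + W2 * (Cconj (fst R) - 1)) +
       (snd V * (fst L - 1) + Cconj (fst V) * snd L))%C by (unfold W2; ring).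
    eapply Rle_trans; [apply Cmod_triangle|].
    assert (EC : Cmod (Cconj (fst R) - 1) = Cmod (fst R - 1)).
    { rewrite <- (Cmod_conj (fst R - 1)), Cminus_conj. do 2 f_equal.
      unfold Cconj, RtoC; simpl; f_equal; ring. }
    assert (K1 : Cmod (W1 * snd R + W2 * (Cconj (fst R) - 1)) <= P * tau) by
      (apply key; rewrite ?EC; lra).
    assert (K2 : Cmod (snd V * (fst L - 1) + Cconj (fst V) * snd L) <= P * tau) by
      (apply key; rewrite ?Cmod_conj; lra).
    lra.
Qed.

Lemma limit_near (f : nat -> C) (l : C) (v : C) (M : nat) (e : R) :
  filterlim f eventually (locally l) -> 0 < e ->
  (forall d : nat, Cmod (f (d + M)%nat - v) <= e) -> Cmod (l - v) <= 2 * e.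
Proof.
  (* Neighbourhoods in the complex plane are products here, so each coordinate receives half of
     [e]. *)
  intros Hl He Hv. assert (He4 : 0 < e / 2) by lra.
  destruct (proj1 (filterlim_locally f l) Hl (mkposreal _ He4)) as [N HN].
  specialize (HN (N + M)%nat ltac:(lia)). specialize (Hv N).
  destruct HN as [B1 B2].
  assert (D : Cmod (f (N + M)%nat - l) <= e).
  { eapply Rle_trans; [apply Cmod_le_abs|].
    change (Rabs (fst (f (N + M)%nat) - fst l) < e / 2) in B1.
    change (Rabs (snd (f (N + M)%nat) - snd l) < e / 2) in B2.
    destruct (f (N + M)%nat), l; simpl in *. unfold Rminus in *. lra. }
  replace (l - v)%C with (- (f (N + M)%nat - l) + (f (N + M)%nat - v))%C by ring.
  eapply Rle_trans; [apply Cmod_triangle|]. rewrite Cmod_opp. lra.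
Qed.

(** The definition of [r] gives limits for each point of the circle separately; uniformity comes
    from the Cauchy estimate together with the lower bound [c] for the denominators. *)
Lemma reflection_uniform (q : Z -> C) (r : C -> C) (eta : R) :
  rapidly_decreasing q -> (forall n, Cmod (q n) < 1) -> is_reflection_coefficient q r ->
  0 < eta ->
  exists M0 : nat, forall (M : nat) (y : R), (M0 <= M)%nat ->
    Cmod (snd (window q y M) / fst (window q y M) - r (cexp (0, y)))%C <= eta.
Proof.
  intros Hq H1 Hr He.
  destruct (upper_prod_bounded q Hq) as (P & HP1 & HP).
  destruct (lower_prod_bounded q Hq H1) as (c & Hc & HL).
  (* The first bound keeps [Cmod a] above [c / 2]; the second makes the error of the quotient at
     most [eta]. *)
  set (tau := Rmin (c / (8 * P)) (eta * c ^ 2 / (16 * P ^ 2))).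
  assert (Ht : 0 < tau).
  { apply Rmin_pos; apply Rdiv_lt_0_compat; try lra.
    - apply Rmult_lt_0_compat; [lra|now apply pow_lt].
    - apply Rmult_lt_0_compat; [lra|apply pow_lt; lra]. }
  assert (t1 : 4 * P * tau <= c / 2).
  { apply Rle_trans with (4 * P * (c / (8 * P))); [|right; field; lra].
    apply Rmult_le_compat_l; [lra|apply Rmin_l]. }
  assert (t2 : 8 * P ^ 2 * tau <= eta * (c ^ 2 / 2)).
  { apply Rle_trans with (8 * P ^ 2 * (eta * c ^ 2 / (16 * P ^ 2))); [|right; field; lra].
    apply Rmult_le_compat_l; [nra|apply Rmin_r]. }
  destruct (upper_prod_tail q tau Hq Ht) as [M0 HM0].
  exists M0. intros M y HM.
  destruct (Hr (cexp (0, y))) as (a & b & La & Lb & Ha & ->).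
  { rewrite Cmod_cexp. simpl. apply exp_0. }
  assert (Ew : forall N, (m11 (AL_scat_trunc q (cexp (0, y)) N),
                          m21 (AL_scat_trunc q (cexp (0, y)) N)) = window q y N) by
    (intros; apply AL_prod_column).
  assert (W := fun d => window_cauchy q y P tau M d HP
                          (proj1 (HM0 M d HM)) (proj2 (HM0 M d HM))).
  assert (Pt : 0 < 2 * P * tau) by (apply Rmult_lt_0_compat; lra).
  assert (Na : Cmod (a - fst (window q y M)) <= 2 * (2 * P * tau)).
  { apply (limit_near _ a _ M _ La Pt). intros d. specialize (W d).
    rewrite <- !Ew in *. apply W. }
  assert (Nb : Cmod (b - snd (window q y M)) <= 2 * (2 * P * tau)).
  { apply (limit_near _ b _ M _ Lb Pt). intros d. specialize (W d).
    rewrite <- !Ew in *. apply W. }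
  assert (LA : c <= Cmod (fst (window q y M))).
  { eapply Rle_trans; [apply (HL (- Z.of_nat M)%Z (2 * M)%nat)|]. now apply column_window_lower. }
  assert (UA : Cmod (fst (window q y M)) + Cmod (snd (window q y M)) <= P).
  { eapply Rle_trans; [|apply (HP (- Z.of_nat M)%Z (2 * M)%nat)].
    apply column_bound. apply Cmod_circle_power. }
  set (A := fst (window q y M)) in *. set (B := snd (window q y M)) in *.
  assert (La' : c / 2 <= Cmod a).
  { pose proof (Cmod_triangle_minus A a) as T. rewrite Cmod_minus_sym in T. lra. }
  assert (A0 : A <> 0) by (apply Cmod_gt_0; lra).
  replace (B / A - b / a)%C with ((B * (a - A) + - (b - B) * A) / (A * a))%C by (field; auto).
  rewrite Cmod_div by (now apply Cmult_neq_0). rewrite (Cmod_mult A a).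
  assert (PA : 0 < Cmod A * Cmod a) by (apply Rmult_lt_0_compat; lra).
  apply Rmult_le_reg_r with (Cmod A * Cmod a); [exact PA|].
  unfold Rdiv. rewrite Rmult_assoc, Rinv_l, Rmult_1_r by lra.
  apply Rle_trans with (4 * P * tau * P).
  - eapply Rle_trans; [apply Cmod_triangle|]. rewrite !Cmod_mult, Cmod_opp.
    pose proof (Cmod_ge_0 B).
    assert (Cmod B * Cmod (a - A) <= Cmod B * (4 * P * tau)) by (apply Rmult_le_compat_l; lra).
    assert (Cmod (b - B) * Cmod A <= 4 * P * tau * Cmod A) by (apply Rmult_le_compat_r; lra).
    assert (4 * P * tau * (Cmod A + Cmod B) <= 4 * P * tau * P) by
      (apply Rmult_le_compat_l; lra).
    lra.
  - apply Rle_trans with (eta * (c ^ 2 / 2)).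
    + replace (4 * P * tau * P) with (4 * P ^ 2 * tau) by ring.
      assert (0 <= P ^ 2 * tau) by nra. lra.
    + apply Rmult_le_compat_l; [lra|].
      replace (c ^ 2 / 2) with (c * (c / 2)) by field. apply Rmult_le_compat; lra.
Qed.

(** * Analytic reflection coefficients *)

Lemma sub_le_of_derive (f f' : R -> R) (x y : R) :
  (forall t, is_derive f t (f' t)) -> (forall t, Rabs (f' t) <= 1) ->
  Rabs (f y - f x) <= Rabs (y - x).
Proof.
  intros Hf Hf'. destruct (MVT_gen f x y f') as (t & _ & E).
  - intros t _. apply Hf.
  - intros t _. apply continuity_pt_filterlim.
    apply (ex_derive_continuous (K := R_AbsRing) (V := R_NormedModule) f). now exists (f' t).
  - rewrite E, Rabs_mult. pose proof (Hf' t). pose proof (Rabs_pos (y - x)). nra.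
Qed.

Lemma open_circle_annulus (U : C -> Prop) :
  open U -> (forall z, Cmod z = 1 -> U z) ->
  exists del, 0 < del /\ forall x y, 0 <= x <= del -> 0 <= y <= 2 * PI -> U (cexp (x, y)).
Proof.
  intros HU H1.
  (* The radius [2 * e] leaves room for two displacements: the angular one [Rabs (y - t) < e] and
     the radial one [exp x - 1 <= d <= e]. *)
  assert (loc : forall t, {e : posreal | forall x y, Rabs (x - cos t) < 2 * e ->
                             Rabs (y - sin t) < 2 * e -> U (x, y)}).
  { intros t. apply constructive_indefinite_description.
    destruct (HU (cexp (0, t))) as [e He].
    { apply H1. rewrite Cmod_cexp. apply exp_0. }
    assert (He2 : 0 < e / 2) by (pose proof (cond_pos e); lra).
    exists (mkposreal _ He2). simpl. intros x y Hx Hy. apply He.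
    replace (2 * (e / 2)) with (pos e) in * by field.
    unfold cexp; simpl. rewrite exp_0, !Rmult_1_l. split; [exact Hx|exact Hy]. }
  destruct (compactness_value_1d 0 (2 * PI) (fun t => proj1_sig (loc t))) as [d Hd].
  pose proof (cond_pos d) as Pd.
  (* The uniform [d] comes from compactness of the parameter interval; the logarithm converts it to
     the coordinate in which the circle has radius [exp x]. *)
  exists (ln (1 + d)). split.
  { rewrite <- ln_1. apply ln_increasing; lra. }
  intros x y Hx Hy. apply NNPP. intros HN. apply (Hd y Hy). intros (t & Ht & Hyt & Hdt).
  apply HN. destruct (loc t) as [e He]; simpl in *. clear Hd.
  assert (Ex : 0 <= exp x - 1 <= d).
  { pose proof (exp_ineq1_le x). split; [lra|].
    assert (exp x <= 1 + d); [|lra].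
    rewrite <- (exp_ln (1 + d)) by lra. apply exp_le. lra. }
  assert (Cy : Rabs (cos y - cos t) <= Rabs (y - t)).
  { apply (sub_le_of_derive cos (fun t => - sin t)); [apply is_derive_cos|].
    intros s. apply Rabs_le. pose proof (SIN_bound s). lra. }
  assert (Sy : Rabs (sin y - sin t) <= Rabs (y - t)).
  { apply (sub_le_of_derive sin cos); [apply is_derive_sin|].
    intros s. apply Rabs_le. pose proof (COS_bound s). lra. }
  assert (step : forall p c, Rabs p <= 1 -> Rabs (p - c) <= Rabs (y - t) ->
            Rabs (exp x * p - c) < 2 * e).
  { intros p c Hp Hpc. replace (exp x * p - c) with ((exp x - 1) * p + (p - c)) by ring.
    eapply Rle_lt_trans; [apply Rabs_triang|].
    rewrite Rabs_mult, (Rabs_pos_eq (exp x - 1)) by lra.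
    pose proof (Rabs_pos p).
    assert ((exp x - 1) * Rabs p <= d * 1) by (apply Rmult_le_compat; lra). lra. }
  change (U (exp x * cos y, exp x * sin y)).
  apply He; apply step; auto; apply Rabs_le.
  - pose proof (COS_bound y). lra.
  - pose proof (SIN_bound y). lra.
Qed.

Lemma holomorphic_bounded_on_circle (f : C -> C) (x : R) :
  (forall y, 0 <= y <= 2 * PI -> holomorphic_at f (x, y)) ->
  exists K, 0 <= K /\ forall y, 0 <= y <= 2 * PI -> Cmod (f (x, y)) <= K.
Proof.
  intros H. pose proof PI_RGT_0.
  destruct (continuity_ab_maj (fun y => Cmod (f (x, y))) 0 (2 * PI)) as (y0 & M & _).
  - lra.
  - intros y Hy e He.
    assert (shift : forall v : R, ((x, y) + (0, (v - y)%R))%C = (x, v)) by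
      (intros; unfold Cplus; simpl; f_equal; ring).
    destruct (holomorphic_continuous f (x, y) (H y Hy) (e / 2)) as (d & Hd & F); [lra|].
    exists d; split; [exact Hd|].
    change (forall v : R, D_x no_cond y v /\ Rabs (v - y) < d ->
              Rabs (Cmod (f (x, v)) - Cmod (f (x, y))) < e).
    intros v [_ Hv].
    specialize (F (0, v - y)). rewrite Cplus_0_r in F.
    rewrite shift in F.
    assert (D : Cmod (0, (v - y)%R) < d).
    { eapply Rle_lt_trans; [apply Cmod_le_abs|]. simpl. rewrite Rabs_R0, Rplus_0_l.
      exact Hv. }
    specialize (F D).
    pose proof (Cmod_triangle_minus (f (x, v)) (f (x, y))) as T1.
    pose proof (Cmod_triangle_minus (f (x, y)) (f (x, v))) as T2.
    rewrite Cmod_minus_sym in T2. apply Rabs_lt_between. lra.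
  - exists (Cmod (f (x, y0))). split; [apply Cmod_ge_0|]. intros y Hy. now apply M.
Qed.

Lemma holomorphic_cexp_IZR (n : Z) (w : C) :
  holomorphic_at (fun v => cexp (RtoC (IZR n) * v)) w.
Proof.
  apply (holomorphic_comp cexp (fun v => (RtoC (IZR n) * v)%C)); [apply holomorphic_cexp|].
  apply holomorphic_mult; [apply holomorphic_const|apply holomorphic_id].
Qed.

Lemma exp_le_1 (x : R) : x <= 0 -> exp x <= 1.
Proof. intros H. rewrite <- exp_0. now apply exp_le. Qed.

(* The first summand on the right is analytic inside the circle, the second outside. *)
Lemma window_identity (q : Z -> C) (y : R) (N M : nat) :
  (N < M)%nat -> (forall n, Cmod (q n) < 1) ->
  let w := (0, y) in
  let k := (M - N)%nat in
  (fst (schur q (Z.of_nat N) k 1 0 (cexp (RtoC (IZR (-2)) * w))) *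
   (snd (window q y M) / fst (window q y M)) * cexp (RtoC (IZR (- (2 * Z.of_nat N + 1))) * w)
   = fst (schur (fun n => Cconj (q n)) (Z.of_nat N) k 0 1 (cexp (RtoC (IZR 2) * w)))
     + det_prod q (Z.of_nat N) k *
       (snd (schur q (- Z.of_nat M) (M + N) 1 0 (cexp (RtoC (IZR (-2)) * w))) /
        fst (schur q (- Z.of_nat M) (2 * M) 1 0 (cexp (RtoC (IZR (-2)) * w)))))%C.
Proof.
  intros HNM Hq w k.
  set (om := circle_power y).
  assert (Hom : forall n, Cmod (om n) = 1) by apply Cmod_circle_power.
  set (z := cexp (RtoC (IZR (-2)) * w)). set (z' := cexp (RtoC (IZR 2) * w)).
  assert (Hz : forall n, om n = (om (n + 1)%Z * z)%C).
  { intros n. unfold z, w. change (-2)%Z with (2 * -1)%Z.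
    unfold om. rewrite <- circle_power_shift. f_equal; lia. }
  assert (Hz' : forall n, om (n + 1)%Z = (om n * z')%C) by
    (intros n; apply (circle_power_shift y n 1)).
  pose proof (column_schur q om z (Z.of_nat N) k Hom Hz) as CR.
  pose proof (column_schur q om z (- Z.of_nat M) (M + N) Hom Hz) as CL.
  pose proof (column_schur q om z (- Z.of_nat M) (2 * M) Hom Hz) as CV.
  destruct (column_schur_reversed q om z' (Z.of_nat N) k Hom Hz') as [CB _].
  pose proof (column_det q om (Z.of_nat N) k Hom) as Det. cbv zeta in Det.
  pose proof (column_app q om (- Z.of_nat M) (M + N) k) as App. cbv zeta in App.
  replace (M + N + k)%nat with (2 * M)%nat in App by (unfold k; lia).
  replace (- Z.of_nat M + Z.of_nat (M + N))%Z with (Z.of_nat N) in * by lia.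
  assert (V0 : fst (column q om (- Z.of_nat M) (2 * M)) <> 0).
  { rewrite CV. cbn [fst]. apply Cmod_gt_0.
    assert (Hz1 : Cmod z <= 1) by (unfold z, w; rewrite Cmod_cexp_IZR, Rmult_0_r, exp_0; lra).
    destruct (schur_lower q (- Z.of_nat M) (2 * M) z Hz1 Hq) as [_ L].
    eapply Rlt_le_trans; [|exact L]. now apply lower_prod_pos. }
  assert (EX : fst (schur q (- Z.of_nat M) (2 * M) 1 0 z)
               = fst (column q om (- Z.of_nat M) (2 * M))) by now rewrite CV.
  assert (EA : fst (schur q (Z.of_nat N) k 1 0 z) = fst (column q om (Z.of_nat N) k)) by
    now rewrite CR.
  assert (EY : snd (column q om (- Z.of_nat M) (M + N))
               = (om (Z.of_nat N) * snd (schur q (- Z.of_nat M) (M + N) 1 0 z))%C) by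
    now rewrite CL.
  rewrite EX, EA. unfold window. fold om.
  replace (cexp (RtoC (IZR (- (2 * Z.of_nat N + 1))) * w)) with (/ om (Z.of_nat N))%C.
  2:{ unfold om, circle_power. rewrite <- cexp_opp. f_equal. rewrite opp_IZR, RtoC_opp.
      unfold w. ring. }
  assert (O0 : om (Z.of_nat N) <> 0) by (apply Cmod_gt_0; rewrite Hom; lra).
  set (o := om (Z.of_nat N)) in *.
  set (V := column q om (- Z.of_nat M) (2 * M)) in *.
  set (L := column q om (- Z.of_nat M) (M + N)) in *.
  set (Rt := column q om (Z.of_nat N) k) in *.
  set (fb := fst (schur (fun n => Cconj (q n)) (Z.of_nat N) k 0 1 z')) in *.
  set (fy := snd (schur q (- Z.of_nat M) (M + N) 1 0 z)) in *.
  (* Eliminating the first entry of the left part from the two product formulas leaves the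
     determinant of the right part as coefficient. *)
  assert (E : (fst Rt * snd V = snd Rt * fst V + det_prod q (Z.of_nat N) k * snd L)%C).
  { rewrite <- Det. rewrite App. cbn [fst snd]. ring. }
  rewrite EY, CB in E.
  transitivity ((fst Rt * snd V) / (fst V * o))%C; [field; auto|].
  rewrite E. field. auto.
Qed.

(** Quantitative form of the averaging argument. [F1] is the inner term minus its value at the
    centre, [F2] the outer term, and [F3] the left-hand side with [B / A] replaced by the
    continuation [g]. *)
Lemma inverse_scattering_bound (q : Z -> C) (g : C -> C) (P del K eta : R) (N M : nat) :
  (N < M)%nat -> (forall n, Cmod (q n) < 1) ->
  (forall m k, upper_prod q m k <= P) -> 0 < del -> 0 <= K -> 0 <= eta ->
  (forall x y, 0 <= x <= del -> 0 <= y <= 2 * PI -> holomorphic_at g (cexp (x, y))) ->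
  (forall y, 0 <= y <= 2 * PI -> Cmod (g (cexp (del, y))) <= K) ->
  (forall y, Cmod (snd (window q y M) / fst (window q y M) - g (cexp (0, y)))%C <= eta) ->
  Cmod (q (Z.of_nat N)) <= P * (K * exp (- (del * INR N)) + eta).
Proof.
  intros HNM Hq HP Hdel HK Heta Hg HgK Hgr. pose proof PI_RGT_0 as Hpi.
  set (k := (M - N)%nat). set (n := Z.of_nat N).
  (* [circle_integral] records real parts only; multiplying everything by [Cconj (q n)] turns the
     central value into the real number [Q ^ 2]. *)
  set (cq := Cconj (q n)). set (Q := Cmod (q n)).
  assert (HQ : Cmod cq = Q) by apply Cmod_conj.
  assert (HP1 : 1 <= P) by (eapply Rle_trans; [apply (upper_prod_ge_1 q 0 0)|apply HP]).
  set (zm := fun w : C => cexp (RtoC (IZR (-2)) * w)).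
  set (zp := fun w : C => cexp (RtoC (IZR 2) * w)).
  set (zN := fun w : C => cexp (RtoC (IZR (- (2 * n + 1))) * w)).
  assert (Czm : forall x y, 0 <= x -> Cmod (zm (x, y)) <= 1).
  { intros x y Hx. unfold zm. rewrite Cmod_cexp_IZR. apply exp_le_1. lra. }
  assert (Czp : forall x y, x <= 0 -> Cmod (zp (x, y)) <= 1).
  { intros x y Hx. unfold zp. rewrite Cmod_cexp_IZR. apply exp_le_1. lra. }
  set (Fa := fun w => fst (schur q n k 1 0 (zm w))).
  set (Fb := fun w => fst (schur (fun n => Cconj (q n)) n k 0 1 (zp w))).
  set (Fx := fun w => fst (schur q (- Z.of_nat M) (2 * M) 1 0 (zm w))).
  set (Fy := fun w => snd (schur q (- Z.of_nat M) (M + N) 1 0 (zm w))).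
  set (F1 := fun w => (cq * (Fb w - q n))%C).
  set (F2 := fun w => (cq * det_prod q n k * (Fy w * / Fx w))%C).
  set (F3 := fun w => (cq * Fa w * g (cexp w) * zN w)%C).
  pose proof (lower_prod_pos q (- Z.of_nat M) (2 * M) Hq) as Lx.
  assert (Fx_low : forall x y, 0 <= x ->
            lower_prod q (- Z.of_nat M) (2 * M) <= Cmod (Fx (x, y))).
  { intros x y Hx. now apply schur_lower; [apply Czm|]. }
  assert (Fa_bound : forall x y, 0 <= x -> Cmod (Fa (x, y)) <= P).
  { intros x y Hx. pose proof (schur_bound q n k 1 0 (zm (x, y)) (Czm x y Hx)) as B.
    cbv zeta in B. rewrite Cmod_0, Cmod_1 in B. specialize (HP n k).
    pose proof (Cmod_ge_0 (snd (schur q n k 1 0 (zm (x, y))))). unfold Fa. lra. }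
  assert (H1 : forall w, holomorphic_at F1 w).
  { intros w. unfold F1. apply holomorphic_mult; [apply holomorphic_const|].
    apply (holomorphic_plus Fb (fun _ => - q n)%C); [|apply holomorphic_const].
    apply schur_holomorphic. apply holomorphic_cexp_IZR. }
  assert (H2 : forall x y, 0 <= x -> holomorphic_at F2 (x, y)).
  { intros x y Hx. unfold F2. apply holomorphic_mult; [apply holomorphic_const|].
    apply holomorphic_mult; [apply schur_holomorphic, holomorphic_cexp_IZR|].
    apply (holomorphic_inv Fx).
    - apply Cmod_gt_0. specialize (Fx_low x y Hx). lra.
    - apply schur_holomorphic, holomorphic_cexp_IZR. }
  assert (H3 : forall x y, 0 <= x <= del -> 0 <= y <= 2 * PI -> holomorphic_at F3 (x, y)).
  { intros x y Hx Hy. unfold F3. apply holomorphic_mult; [|apply holomorphic_cexp_IZR].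
    apply holomorphic_mult; [apply holomorphic_mult; [apply holomorphic_const|]|].
    - apply schur_holomorphic, holomorphic_cexp_IZR.
    - apply (holomorphic_comp g cexp); [now apply Hg|apply holomorphic_cexp]. }
  assert (I1 : circle_integral F1 0 = 0).
  { destruct k as [|k'] eqn:Ek; [lia|].
    destruct (schur_fst_near_0 (fun n => Cconj (q n)) n k') as (K1 & HK1 & B1).
    apply (circle_integral_inner_vanish F1 (Q * K1)).
    - intros; apply H1.
    - intros x. unfold F1, Fb, zp. now rewrite cexp_IZR_periodic.
    - intros x y Hx. unfold F1. rewrite Cmod_mult, HQ, Rmult_assoc.
      apply Rmult_le_compat_l; [apply Cmod_ge_0|].
      specialize (B1 (zp (x, y)) (Czp x y Hx)). cbv beta in B1. rewrite Cconj_conj in B1.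
      eapply Rle_trans; [exact B1|]. apply Rmult_le_compat_l; [exact HK1|].
      unfold zp. rewrite Cmod_cexp_IZR. apply exp_le. lra. }
  assert (I2 : circle_integral F2 0 = 0).
  { set (lo := lower_prod q (- Z.of_nat M) (2 * M)) in *.
    apply (circle_integral_outer_vanish F2 (Q * Cmod (det_prod q n k) * (P * / lo))).
    - exact H2.
    - intros x. unfold F2, Fy, Fx, zm. now rewrite cexp_IZR_periodic.
    - intros x y Hx. unfold F2. rewrite !Cmod_mult, HQ.
      rewrite (Rmult_assoc (Q * _)).
      apply Rmult_le_compat_l; [apply Rmult_le_pos; apply Cmod_ge_0|].
      specialize (Fx_low x y Hx).
      rewrite Cmod_inv by (apply Cmod_gt_0; lra).
      assert (Y : Cmod (Fy (x, y)) <= exp (- x) * P).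
      { pose proof (schur_snd_bound q (- Z.of_nat M) (M + N) 1 0 (zm (x, y)) (Czm x y Hx)
                      (fun _ => eq_refl)) as B.
        rewrite Cmod_0, Cmod_1, Rplus_0_r, Rmult_1_r in B.
        eapply Rle_trans; [exact B|]. pose proof (upper_prod_ge_1 q (- Z.of_nat M) (M + N)).
        apply Rmult_le_compat; [apply Cmod_ge_0|lra| |apply HP].
        unfold zm. rewrite Cmod_cexp_IZR. apply exp_le. lra. }
      assert (/ Cmod (Fx (x, y)) <= / lo) by (apply Rinv_le_contravar; lra).
      assert (0 < / Cmod (Fx (x, y))) by (apply Rinv_0_lt_compat; lra).
      replace (P * / lo * exp (- x)) with (exp (- x) * P * / lo) by ring.
      apply Rmult_le_compat; [apply Cmod_ge_0|lra|exact Y|lra]. }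
  assert (I3 : Rabs (circle_integral F3 0) <= 2 * PI * (Q * P * K * exp (- (del * INR N)))).
  { rewrite (circle_integral_eq F3 0 del); [|lra|exact H3|].
    2:{ intros x. unfold F3, Fa, zm, zN.
        rewrite (cexp_IZR_periodic (-2)), (cexp_IZR_periodic (- (2 * n + 1))).
        pose proof (cexp_IZR_periodic 1 x) as E1. rewrite !Cmult_1_l in E1. now rewrite E1. }
    apply circle_integral_bound; [intros; apply H3; lra|].
    intros y Hy. unfold F3. rewrite !Cmod_mult, HQ.
    apply Rmult_le_compat.
    - repeat apply Rmult_le_pos; apply Cmod_ge_0.
    - apply Cmod_ge_0.
    - apply Rmult_le_compat; [apply Rmult_le_pos; apply Cmod_ge_0|apply Cmod_ge_0| |].
      + apply Rmult_le_compat_l; [apply Cmod_ge_0|]. apply Fa_bound. lra.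
      + now apply HgK.
    - unfold zN. rewrite Cmod_cexp_IZR. apply exp_le.
      rewrite opp_IZR, plus_IZR, mult_IZR. unfold n. rewrite <- INR_IZR_INZ.
      pose proof (pos_INR N). nra. }
  (* On the unit circle [window_identity] would make this difference zero with the quotient [B / A];
     replacing the quotient by [g] costs [eta] times the bounds on [cq] and [Fa]. *)
  assert (near : forall y, Rabs (fst (F3 (0, y)) - fst (F1 (0, y)) - fst (F2 (0, y)) - Q ^ 2)
                 <= Q * P * eta).
  { intros y.
    replace (fst (F3 (0, y)) - fst (F1 (0, y)) - fst (F2 (0, y)) - Q ^ 2)
      with (fst (F3 (0, y) - F1 (0, y) - F2 (0, y) - cq * q n)%C).
    2:{ unfold cq. rewrite Cmult_comm, <- Cmod2_conj. fold Q.
        simpl. ring. }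
    eapply Rle_trans; [apply abs_fst_le_Cmod|].
    pose proof (window_identity q y N M HNM Hq) as W. cbv zeta in W. fold n k in W.
    set (rM := (snd (window q y M) / fst (window q y M))%C) in *.
    change (Fa (0, y) * rM * zN (0, y)
            = Fb (0, y) + det_prod q n k * (Fy (0, y) / Fx (0, y)))%C in W.
    replace (F3 (0, y) - F1 (0, y) - F2 (0, y) - cq * q n)%C
      with (- (cq * Fa (0, y) * zN (0, y) * (rM - g (cexp (0, y)))))%C.
    2:{ unfold F3, F1, F2.
        transitivity (cq * Fa (0, y) * g (cexp (0, y)) * zN (0, y)
          - cq * (Fb (0, y) + det_prod q n k * (Fy (0, y) / Fx (0, y))))%C;
          [rewrite <- W; ring|unfold Cdiv; ring]. }
    rewrite Cmod_opp, !Cmod_mult, HQ.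
    replace (Cmod (zN (0, y))) with 1 by
      (unfold zN; now rewrite Cmod_cexp_IZR, Rmult_0_r, exp_0).
    rewrite Rmult_1_r.
    apply Rmult_le_compat; [apply Rmult_le_pos; apply Cmod_ge_0|apply Cmod_ge_0| |apply Hgr].
    apply Rmult_le_compat_l; [apply Cmod_ge_0|]. apply Fa_bound. lra. }
  assert (X1 := ex_circle_integral F1 0 (fun y _ => H1 (0, y))).
  assert (X2 := ex_circle_integral F2 0 (fun y _ => H2 0 y (Rle_refl 0))).
  assert (X3 : ex_RInt (fun y => fst (F3 (0, y))) 0 (2 * PI)) by
    (apply ex_circle_integral; intros; apply H3; lra).
  assert (X31 := ex_RInt_minus (V := R_NormedModule) _ _ _ _ X3 X1).
  assert (X312 := ex_RInt_minus (V := R_NormedModule) _ _ _ _ X31 X2).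
  pose proof (RInt_near_const
    (fun y => fst (F3 (0, y)) - fst (F1 (0, y)) - fst (F2 (0, y)))
    0 (2 * PI) (Q ^ 2) (Q * P * eta)) as R.
  rewrite Rplus_0_l in R. specialize (R ltac:(lra) X312 (fun y _ => near y)).
  replace (RInt (fun y => fst (F3 (0, y)) - fst (F1 (0, y)) - fst (F2 (0, y))) 0 (2 * PI))
    with (circle_integral F3 0 - circle_integral F1 0 - circle_integral F2 0) in R.
  2:{ symmetry. unfold circle_integral.
      etransitivity; [apply (RInt_minus (V := R_CompleteNormedModule) _ _ _ _ X31 X2)|].
      unfold minus, plus, opp; simpl. unfold Rminus. f_equal.
      apply (RInt_minus (V := R_CompleteNormedModule) _ _ _ _ X3 X1). }
  rewrite I1, I2, !Rminus_0_r in R.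
  apply Rabs_le_between in R. apply Rabs_le_between in I3.
  fold Q. pose proof (Cmod_ge_0 (q n)) as Q0. fold Q in Q0.
  (* All terms carry a factor [Q], which is cancelled; when [Q = 0] the claim is immediate. *)
  destruct Q0 as [Q0|Q0].
  - apply Rmult_le_reg_l with (2 * PI * Q); [apply Rmult_lt_0_compat; lra|].
    replace (2 * PI * Q * Q) with (2 * PI * Q ^ 2) by ring.
    replace (2 * PI * Q * (P * (K * exp (- (del * INR N)) + eta))) with
      (2 * PI * (Q * P * K * exp (- (del * INR N))) + 2 * PI * (Q * P * eta)) by ring.
    lra.
  - rewrite <- Q0. pose proof (exp_pos (- (del * INR N))).
    apply Rmult_le_pos; [lra|]. nra.
Qed.

Theorem exponential_tail_of_analytic_reflection (q : Z -> C) (r : C -> C) :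
  rapidly_decreasing q -> (forall n, Cmod (q n) < 1) ->
  is_reflection_coefficient q r -> analytic_on_circle r ->
  exists del A, 0 < del /\ 0 < A /\
    forall n, (0 <= n)%Z -> Cmod (q n) <= A * exp (- (del * IZR n)).
Proof.
  intros Hq H1 Hr (U & g & HU & HU1 & Hg & Hgr).
  destruct (open_circle_annulus U HU HU1) as (del & Hdel & HUd).
  assert (hol : forall x y, 0 <= x <= del -> 0 <= y <= 2 * PI -> holomorphic_at g (cexp (x, y))).
  { intros x y Hx Hy. apply holomorphic_of_ex_derive, Hg. now apply HUd. }
  destruct (holomorphic_bounded_on_circle (fun w => g (cexp w)) del) as (K & HK & BK).
  { intros y Hy. apply (holomorphic_comp g cexp); [apply hol; lra|apply holomorphic_cexp]. }
  destruct (upper_prod_bounded q Hq) as (P & HP1 & HP).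
  exists del, (P * (K + 1)). split; [exact Hdel|]. split; [nra|].
  intros n Hn. rewrite <- (Z2Nat.id n Hn). set (N := Z.to_nat n). rewrite <- INR_IZR_INZ.
  set (E := exp (- (del * INR N))). assert (HE : 0 < E) by apply exp_pos.
  (* The tolerance is the desired decay [E] itself. The window size may depend on [N], because [P],
     [K] and [del] do not depend on the window. *)
  destruct (reflection_uniform q r E Hq H1 Hr HE) as [M0 HM0].
  set (M := (M0 + S N)%nat).
  replace (P * (K + 1) * E) with (P * (K * E + E)) by ring.
  apply (inverse_scattering_bound q g P del K E N M); auto; [unfold M; lia|lra|].
  intros y. rewrite Hgr.
  - apply HM0. unfold M. lia.
  - rewrite Cmod_cexp. apply exp_0.
Qed.

Theorem theorem2p2 (u : R -> Z -> C) :
  is_AL_solution u ->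
  rapidly_decreasing (u 0) ->
  (forall n : Z, Cmod (u 0 n) < 1) ->
  forall V0 : R, 0 < V0 ->
    (forall j : nat, (1 <= j)%nat ->
       exists C0 : R, 0 < C0 /\
         forall (t : R) (n : Z), 0 <= t -> IZR n > (2 + V0) * t ->
           Cmod (u t n) <= C0 * / (IZR n ^ j))
    /\
    (forall r : C -> C, is_reflection_coefficient (u 0) r -> analytic_on_circle r ->
       exists rho C0 : R, 0 < rho < 1 /\ 0 < C0 /\
         forall (t : R) (n : Z), 0 <= t -> IZR n > (2 + V0) * t ->
           Cmod (u t n) <= C0 * rho ^ Z.to_nat n).
Proof.
  intros Hu Hd H1 V0 HV. split.
  - intros j Hj. now apply AL_polynomial_decay.
  - intros r Hr Ha.
    destruct (exponential_tail_of_analytic_reflection (u 0) r Hd H1 Hr Ha)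
      as (del & A & Hdel & HA & B).
    now apply (AL_exponential_decay u V0 del A).
Qed.
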